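(* Let $(\mathbb{C},\mathbb{A},\lambda)$ be an entwining structure in $\mathcal V$ and let $g:I\to C$ be a group-like element of $\mathbb{C}$. Then the functor $$\bar F:\mathcal V_{A^{\mathbb C}}\to \mathcal V^{\mathbb C}_{\mathbb A}(\lambda),\qquad X\mapsto (X\otimes_{A^{\mathbb C}}A,\; X\otimes_{A^{\mathbb C}}m_A,\; X\otimes_{A^{\mathbb C}}g_A)$$ is an equivalence of categories if and only if $A$ is $(\mathbb{C},g)$-Galois and the extension-of-scalars functor $F_{i_A}=-\otimes_{A^{\mathbb C}}A:\mathcal V_{A^{\mathbb C}}\to\mathcal V_{\mathbb A}$ is comonadic.
   Context: $\mathcal V=(V,\otimes,I)$ is a strict monoidal category with equalizers and with coequalizers, and the tensor product preserves coequalizers in both variables. The name of an object also denotes its identity morphism. For an algebra (monoid) $B$ in $\mathcal V$, $\mathcal V_B$ is the category of right $B$-modules; $M\otimes_B N$ is the usual coequalizer. An entwining structure $(\mathbb C,\mathbb A,\lambda)$ consists of an algebra $\mathbb A=(A,e_A,m_A)$, a coalgebra (comonoid) $\mathbb C=(C,\varepsilon_C,\delta_C)$ in $\mathcal V$ and a morphism $\lambda:C\otimes A\to A\otimes C$ such that $\lambda(C\otimes e_A)=e_A\otimes C$, $(A\otimes\varepsilon_C)\lambda=\varepsilon_C\otimes A$, $(A\otimes\delta_C)\lambda=(\lambda\otimes C)(C\otimes\lambda)(\delta_C\otimes A)$ and $\lambda(C\otimes m_A)=(m_A\otimes C)(A\otimes\lambda)(\lambda\otimes A)$. $\mathcal V^{\mathbb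 C}_{\mathbb A}(\lambda)$ is the category of triples $(X,\xi_X,\nu_X)$ with $(X,\xi_X:X\otimes A\to X)$ a right $A$-module, $(X,\nu_X:X\to X\otimes C)$ a right $C$-comodule and $\nu_X\xi_X=(\xi_X\otimes C)(X\otimes\lambda)(\nu_X\otimes A)$; morphisms are morphisms of $\mathcal V$ that are both $A$-module and $C$-comodule morphisms. A group-like element of $\mathbb C$ is a morphism $g:I\to C$ with $\varepsilon_C g=1_I$ and $\delta_C g=g\otimes g$. Put $g_A=\lambda(g\otimes A):A\to A\otimes C$; this makes $A$ a right $C$-comodule. Let $i_A:A^{\mathbb C}\to A$ be the equalizer of $g_A$ and $A\otimes g:A\to A\otimes C$; $A^{\mathbb C}$ carries an algebra structure making $i_A$ an algebra morphism, and $A$ is regarded as an $A^{\mathbb C}$-bimodule via $i_A$. The functor $F_{i_A}$ sends $X$ to $(X\otimes_{A^{\mathbb C}}A,\,X\otimes_{A^{\mathbb C}}m_A)$; its right adjoint is restriction of scalars along $i_A$. Let $\mathrm{can}:A\otimes_{A^{\mathbb C}}A\to A\otimes C$ be the morphism induced on the quotient $A\otimes_{A^{\mathbb C}}A$ by $(m_A\otimes C)(A\otimes g_A):A\otimes A\to A\otimes C$. It is a morphism of $A$-corings from the canonical coring $A\otimes_{A^{\mathbb C}}A$ to the coring $A\otimes C$ determined by $\lambda$ (with counit $A\otimes\varepsilon_C$ and comultiplication $A\otimes\delta_C$). $A$ is called $(\mathbb C,g)$-Galois if $\mathrm{can}$ is an isomorphism (of $A$-corings; equivalently, an isomorphism in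 $\mathcal V$). A functor with a right adjoint is comonadic if the Eilenberg–Moore comparison functor to the category of coalgebras over the induced comonad is an equivalence. *)

(* Defs.v *)
From mathcomp Require Import ssreflect ssrfun ssrbool.
From Stdlib Require Import ProofIrrelevance ClassicalEpsilon.

Set Implicit Arguments.
Unset Strict Implicit.
Unset Printing Implicit Defensive.

Declare Scope cat_scope.
Delimit Scope cat_scope with cat.
Local Open Scope cat_scope.

Record category := Category {
  obj :> Type;
  hom : obj -> obj -> Type;
  idc : forall X, hom X X;
  cmp : forall X Y Z, hom Y Z -> hom X Y -> hom X Z;
  cmpA : forall X Y Z T (h : hom Z T) (g : hom Y Z) (f : hom X Y),
    cmp h (cmp g f) = cmp (cmp h g) f;
  cmp1l : forall X Y (f : hom X Y), cmp (idc Y) f = f;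
  cmp1r : forall X Y (f : hom X Y), cmp f (idc X) = f }.

Arguments idc {c} X.
Notation "g • f" := (cmp g f) (at level 40, left associativity) : cat_scope.

Record functor (C D : category) := Functor {
  fobj :> C -> D;
  fmap : forall X Y, hom X Y -> hom (fobj X) (fobj Y);
  fmap1 : forall X, fmap (idc X) = idc (fobj X);
  fmapM : forall X Y Z (g : hom Y Z) (f : hom X Y),
    fmap (g • f) = fmap g • fmap f }.

Definition idF (C : category) : functor C C :=
  @Functor C C (fun X => X) (fun _ _ f => f)
    (fun _ => erefl) (fun _ _ _ _ _ => erefl).

Definition compF (C D E : category) (G : functor D E) (F : functor C D) :
  functor C E.
Proof.
refine (@Functor C E (fun X => G (F X)) (fun _ _ f => fmap G (fmap F f)) _ _).
- by move=> X; rewrite !fmap1.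
- by move=> X Y Z g f; rewrite !fmapM.
Defined.

Definition natural (C D : category) (F G : functor C D)
    (t : forall X, hom (F X) (G X)) : Prop :=
  forall X Y (f : hom X Y), t Y • fmap F f = fmap G f • t X.

Definition naturally_isomorphic (C D : category) (F G : functor C D) : Prop :=
  exists (t : forall X, hom (F X) (G X)) (s : forall X, hom (G X) (F X)),
    [/\ natural t, forall X, s X • t X = idc (F X)
      & forall X, t X • s X = idc (G X)].

Definition is_equivalence (C D : category) (F : functor C D) : Prop :=
  exists G : functor D C,
    naturally_isomorphic (compF G F) (idF C) /\
    naturally_isomorphic (compF F G) (idF D).

Record adjunction (C D : category) (F : functor C D) (G : functor D C) :=
  Adjunction {
    aunit : forall X, hom X (G (F X));
    acounit : forall Y, hom (F (G Y)) Y;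
    aunit_nat : natural (F := idF C) (G := compF G F) aunit;
    acounit_nat : natural (F := compF F G) (G := idF D) acounit;
    triangleF : forall X, acounit (F X) • fmap F (aunit X) = idc (F X);
    triangleG : forall Y, fmap G (acounit Y) • aunit (G Y) = idc (G Y) }.

Record comonad (D : category) := Comonad {
  cmd_fun :> functor D D;
  cmd_counit : forall Y, hom (cmd_fun Y) Y;
  cmd_comult : forall Y, hom (cmd_fun Y) (cmd_fun (cmd_fun Y));
  cmd_counit_nat : natural (F := cmd_fun) (G := idF D) cmd_counit;
  cmd_comult_nat :
    natural (F := cmd_fun) (G := compF cmd_fun cmd_fun) cmd_comult;
  cmd_counitl : forall Y, cmd_counit (cmd_fun Y) • cmd_comult Y = idc _;
  cmd_counitr : forall Y, fmap cmd_fun (cmd_counit Y) • cmd_comult Y = idc _;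
  cmd_coassoc : forall Y, cmd_comult (cmd_fun Y) • cmd_comult Y
                        = fmap cmd_fun (cmd_comult Y) • cmd_comult Y }.

Definition adj_comonad (C D : category) (F : functor C D) (G : functor D C)
  (a : adjunction F G) : comonad D.
Proof.
refine (@Comonad D (compF F G) (acounit a)
  (fun Y => fmap F (aunit a (G Y))) _ _ _ _ _).
- exact: acounit_nat.
- move=> X Y f /=; rewrite -!fmapM; congr fmap.
  exact: (aunit_nat a (fmap G f)).
- by move=> Y; exact: (triangleF a).
- by move=> Y /=; rewrite -fmapM (triangleG a) fmap1.
- move=> Y /=; rewrite -!fmapM; congr fmap.
  exact: (aunit_nat a (aunit a (G Y))).
Defined.

Record coalgebra (D : category) (W : comonad D) := Coalgebra {
  coa_obj :> D;
  coa_str : hom coa_obj (W coa_obj);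
  coa_counit : cmd_counit W coa_obj • coa_str = idc _;
  coa_coassoc : cmd_comult W coa_obj • coa_str = fmap W coa_str • coa_str }.

Lemma sig_inj (T : Type) (P : T -> Prop) (x y : {t : T | P t}) :
  proj1_sig x = proj1_sig y -> x = y.
Proof.
case: x => x px; case: y => y py /= e; subst y.
by rewrite (proof_irrelevance _ px py).
Qed.

Section CoalgebraCategory.
Context (D : category) (W : comonad D).

Definition coalgebra_map (X Y : coalgebra W) (f : hom (coa_obj X) (coa_obj Y)) :
  Prop := coa_str Y • f = fmap W f • coa_str X.

Lemma coalgebra_map1 (X : coalgebra W) : coalgebra_map (X := X) (idc _).
Proof. by rewrite /coalgebra_map fmap1 cmp1l cmp1r. Qed.

Lemma coalgebra_mapM (X Y Z : coalgebra W) (g : hom Y Z) (f : hom X Y) :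
  coalgebra_map g -> coalgebra_map f -> coalgebra_map (g • f).
Proof.
rewrite /coalgebra_map => hg hf.
by rewrite fmapM cmpA hg -cmpA hf cmpA.
Qed.

Definition coalgebra_cat : category.
Proof.
refine (@Category (coalgebra W) (fun X Y => {f | @coalgebra_map X Y f})
  (fun X => exist _ _ (coalgebra_map1 X))
  (fun X Y Z g f => exist _ _ (coalgebra_mapM (proj2_sig g) (proj2_sig f)))
  _ _ _).
- by move=> X Y Z T h g f; apply: sig_inj; exact: cmpA.
- by move=> X Y f; apply: sig_inj; exact: cmp1l.
- by move=> X Y f; apply: sig_inj; exact: cmp1r.
Defined.

End CoalgebraCategory.

Section Comparison.
Context (C D : category) (F : functor C D) (G : functor D C).
Context (a : adjunction F G).

Definition comparison_obj (X : C) : coalgebra (adj_comonad a).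
Proof.
refine (@Coalgebra D (adj_comonad a) (F X) (fmap F (aunit a X)) _ _).
- exact: (triangleF a).
- rewrite /= -!fmapM; congr fmap; exact: (aunit_nat a (aunit a X)).
Defined.

Lemma comparison_map (X Y : C) (f : hom X Y) :
  coalgebra_map (X := comparison_obj X) (Y := comparison_obj Y) (fmap F f).
Proof.
rewrite /coalgebra_map /= -!fmapM; congr fmap; exact: (aunit_nat a f).
Qed.

Definition comparison : functor C (coalgebra_cat (adj_comonad a)).
Proof.
refine (@Functor C (coalgebra_cat (adj_comonad a)) comparison_obj
  (fun X Y f => exist _ _ (comparison_map f)) _ _).
- by move=> X; apply: sig_inj; exact: fmap1.
- by move=> X Y Z g f; apply: sig_inj; exact: fmapM.
Defined.

End Comparison.

Definition comonadic (C D : category) (F : functor C D) (G : functor D C)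
  (a : adjunction F G) : Prop := is_equivalence (comparison a).

Arguments comonadic {C D} F {G} a.

(* The base category is presented by one type of arrows with domain and
   codomain maps, so that strictness is a plain equality of arrows and no
   transport along (X ⊗ Y) ⊗ Z = X ⊗ (Y ⊗ Z) is ever needed.  Composition is
   a total function whose value on non-composable pairs is irrelevant: all
   the axioms about it carry a composability hypothesis. *)

Record strict_monoidal := StrictMonoidal {
  ob : Type;
  mor : Type;
  dom : mor -> ob;
  cod : mor -> ob;
  idm : ob -> mor;
  mcomp : mor -> mor -> mor;
  dom_idm : forall X, dom (idm X) = X;
  cod_idm : forall X, cod (idm X) = X;
  dom_mcomp : forall g f, dom g = cod f -> dom (mcomp g f) = dom f;
  cod_mcomp : forall g f, dom g = cod f -> cod (mcomp g f) = cod g;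
  mcompA : forall h g f, dom h = cod g -> dom g = cod f ->
    mcomp h (mcomp g f) = mcomp (mcomp h g) f;
  mcomp_idl : forall f, mcomp (idm (cod f)) f = f;
  mcomp_idr : forall f, mcomp f (idm (dom f)) = f;
  munit : ob;
  tob : ob -> ob -> ob;
  tmor : mor -> mor -> mor;
  dom_tmor : forall f g, dom (tmor f g) = tob (dom f) (dom g);
  cod_tmor : forall f g, cod (tmor f g) = tob (cod f) (cod g);
  tmor_idm : forall X Y, tmor (idm X) (idm Y) = idm (tob X Y);
  tmor_mcomp : forall g f g' f', dom g = cod f -> dom g' = cod f' ->
    tmor (mcomp g f) (mcomp g' f') = mcomp (tmor g g') (tmor f f');
  tobA : forall X Y Z, tob X (tob Y Z) = tob (tob X Y) Z;
  tob1l : forall X, tob munit X = X;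
  tob1r : forall X, tob X munit = X;
  tmorA : forall f g h, tmor f (tmor g h) = tmor (tmor f g) h;
  tmor1l : forall f, tmor (idm munit) f = f;
  tmor1r : forall f, tmor f (idm munit) = f }.

Arguments idm {s} _.
Arguments munit {s}.
Coercion idm : ob >-> mor.

Notation "g ∘ f" := (mcomp g f) (at level 40, left associativity) : cat_scope.
Notation "f ⊗ g" := (tmor f g) (at level 38, left associativity) : cat_scope.
Notation "X ⊠ Y" := (tob X Y) (at level 38, left associativity) : cat_scope.

Section Base.
Context {V : strict_monoidal}.
Implicit Types (X Y Z : ob V) (f g h k q : mor V).

Definition arrow X Y f : Prop := dom f = X /\ cod f = Y.

Definition is_iso f : Prop :=
  exists2 h, arrow (cod f) (dom f) h & h ∘ f = dom f /\ f ∘ h = cod f.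

Definition parallel f g : Prop := dom f = dom g /\ cod f = cod g.

Definition is_equalizer f g i : Prop :=
  [/\ parallel f g, cod i = dom f, f ∘ i = g ∘ i
    & forall h, cod h = dom f -> f ∘ h = g ∘ h ->
        exists! k, arrow (dom h) (dom i) k /\ i ∘ k = h].

Definition is_coequalizer f g q : Prop :=
  [/\ parallel f g, dom q = cod f, q ∘ f = q ∘ g
    & forall h, dom h = cod f -> h ∘ f = h ∘ g ->
        exists! k, arrow (cod q) (cod h) k /\ k ∘ q = h].

(* Choices of (co)equalizers and of the induced arrows.  All of them are
   determined up to unique isomorphism, resp. uniquely. *)
Definition equalizer f g : mor V := epsilon (inhabits f) (is_equalizer f g).
Definition coequalizer f g : mor V := epsilon (inhabits f) (is_coequalizer f g).
Definition fact i h : mor V :=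
  epsilon (inhabits h) (fun k => arrow (dom h) (dom i) k /\ i ∘ k = h).
Definition desc q h : mor V :=
  epsilon (inhabits h) (fun k => arrow (cod q) (cod h) k /\ k ∘ q = h).

End Base.

Record base_category := BaseCategory {
  base_mon :> strict_monoidal;
  has_equalizers : forall f g : mor base_mon, parallel f g ->
    exists i, is_equalizer f g i;
  has_coequalizers : forall f g : mor base_mon, parallel f g ->
    exists q, is_coequalizer f g q;
  tensor_coequalizerl : forall (X : ob base_mon) (f g q : mor base_mon),
    is_coequalizer f g q -> is_coequalizer (X ⊗ f) (X ⊗ g) (X ⊗ q);
  tensor_coequalizerr : forall (X : ob base_mon) (f g q : mor base_mon),
    is_coequalizer f g q -> is_coequalizer (f ⊗ X) (g ⊗ X) (q ⊗ X) }.

Section Structures.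
Context {V : base_category}.
Implicit Types (X Y Z : ob V) (f g h k q : mor V).

Record algebra := Algebra {
  alg_ob :> ob V;
  unt : mor V;
  mul : mor V;
  unt_arrow : arrow munit alg_ob unt;
  mul_arrow : arrow (alg_ob ⊠ alg_ob) alg_ob mul;
  mul1l : mul ∘ (unt ⊗ alg_ob) = alg_ob;
  mul1r : mul ∘ (alg_ob ⊗ unt) = alg_ob;
  mulA : mul ∘ (mul ⊗ alg_ob) = mul ∘ (alg_ob ⊗ mul) }.

Record coalg := Coalg {
  coalg_ob :> ob V;
  cou : mor V;
  com : mor V;
  cou_arrow : arrow coalg_ob munit cou;
  com_arrow : arrow coalg_ob (coalg_ob ⊠ coalg_ob) com;
  com1l : (cou ⊗ coalg_ob) ∘ com = coalg_ob;
  com1r : (coalg_ob ⊗ cou) ∘ com = coalg_ob;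
  comA : (com ⊗ coalg_ob) ∘ com = (coalg_ob ⊗ com) ∘ com }.

Record algebra_hom (B A : algebra) := AlgebraHom {
  ahom :> mor V;
  ahom_arrow : arrow B A ahom;
  ahom1 : ahom ∘ unt B = unt A;
  ahomM : ahom ∘ mul B = mul A ∘ (ahom ⊗ ahom) }.

Record rmodule (B : algebra) := RModule {
  rm_ob :> ob V;
  ract : mor V;
  ract_arrow : arrow (rm_ob ⊠ B) rm_ob ract;
  ract1 : ract ∘ (rm_ob ⊗ unt B) = rm_ob;
  ractA : ract ∘ (ract ⊗ B) = ract ∘ (rm_ob ⊗ mul B) }.

Record lmodule (B : algebra) := LModule {
  lm_ob :> ob V;
  lact : mor V;
  lact_arrow : arrow (B ⊠ lm_ob) lm_ob lact;
  lact1 : lact ∘ (unt B ⊗ lm_ob) = lm_ob;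
  lactA : lact ∘ (B ⊗ lact) = lact ∘ (mul B ⊗ lm_ob) }.

Record entwining (C : coalg) (A : algebra) := Entwining {
  ent :> mor V;
  ent_arrow : arrow (C ⊠ A) (A ⊠ C) ent;
  ent_unt : ent ∘ (C ⊗ unt A) = unt A ⊗ C;
  ent_cou : (A ⊗ cou C) ∘ ent = cou C ⊗ A;
  ent_com : (A ⊗ com C) ∘ ent = (ent ⊗ C) ∘ (C ⊗ ent) ∘ (com C ⊗ A);
  ent_mul : ent ∘ (C ⊗ mul A) = (mul A ⊗ C) ∘ (A ⊗ ent) ∘ (ent ⊗ A) }.

Record grouplike (C : coalg) := Grouplike {
  gl :> mor V;
  gl_arrow : arrow munit C gl;
  gl_cou : cou C ∘ gl = munit;
  gl_com : com C ∘ gl = gl ⊗ gl }.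

Record entwined_module (C : coalg) (A : algebra) (lam : entwining C A) :=
  EntwinedModule {
    em_rmod :> rmodule A;
    coact : mor V;
    coact_arrow : arrow em_rmod (em_rmod ⊠ C) coact;
    coact1 : (em_rmod ⊗ cou C) ∘ coact = em_rmod;
    coactA : (coact ⊗ C) ∘ coact = (em_rmod ⊗ com C) ∘ coact;
    coact_act : coact ∘ ract em_rmod
              = (ract em_rmod ⊗ C) ∘ (em_rmod ⊗ lam) ∘ (coact ⊗ A) }.

Definition module_map (B : algebra) (X Y : rmodule B) f : Prop :=
  arrow X Y f /\ f ∘ ract X = ract Y ∘ (f ⊗ B).

Definition comodule_map (C : coalg) (A : algebra) (lam : entwining C A)
    (X Y : entwined_module lam) f : Prop :=
  coact Y ∘ f = (f ⊗ C) ∘ coact X.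

End Structures.

Arguments algebra : clear implicits.
Arguments coalg : clear implicits.

Section Arrows.
Context {V : strict_monoidal}.
Implicit Types (X Y Z : ob V) (f g h k q : mor V).

Lemma idm_tob X Y : idm (X ⊠ Y) = X ⊗ Y.
Proof. by rewrite tmor_idm. Qed.

Lemma idl Y f : cod f = Y -> Y ∘ f = f.
Proof. by move=> <-; exact: mcomp_idl. Qed.

Lemma idr X f : dom f = X -> f ∘ X = f.
Proof. by move=> <-; exact: mcomp_idr. Qed.

Lemma idl2 X Y f : cod f = X ⊠ Y -> (X ⊗ Y) ∘ f = f.
Proof. by move=> e; rewrite tmor_idm idl. Qed.

Lemma idr2 X Y f : dom f = X ⊠ Y -> f ∘ (X ⊗ Y) = f.
Proof. by move=> e; rewrite tmor_idm idr. Qed.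

Lemma idl3 X Y Z f : cod f = X ⊠ Y ⊠ Z -> (X ⊗ Y ⊗ Z) ∘ f = f.
Proof. by move=> e; rewrite !tmor_idm idl. Qed.

Lemma idr3 X Y Z f : dom f = X ⊠ Y ⊠ Z -> f ∘ (X ⊗ Y ⊗ Z) = f.
Proof. by move=> e; rewrite !tmor_idm idr. Qed.

Lemma tcomp g f g' f' : dom g = cod f -> dom g' = cod f' ->
  (g ⊗ g') ∘ (f ⊗ f') = (g ∘ f) ⊗ (g' ∘ f').
Proof. by move=> e e'; rewrite tmor_mcomp. Qed.

Lemma acomp h g f : dom h = cod g -> dom g = cod f ->
  (h ∘ g) ∘ f = h ∘ (g ∘ f).
Proof. by move=> e e'; rewrite mcompA. Qed.

Lemma coequalizer_epi f g q k k' : is_coequalizer f g q ->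
  dom k = cod q -> dom k' = cod q -> k ∘ q = k' ∘ q -> k = k'.
Proof.
move=> [[d c] dq e u] dk dk' ek.
have cq : cod (k ∘ q) = cod k by rewrite cod_mcomp.
have cq' : cod (k ∘ q) = cod k' by rewrite ek cod_mcomp.
case: (u (k ∘ q)) => [||x [_ ux]].
- by rewrite dom_mcomp.
- by rewrite -!mcompA // ?e // -?d -?c.
by rewrite -(ux k) ?(ux k') //; do !split; rewrite ?cq ?cq'.
Qed.

Lemma equalizer_mono f g i k k' : is_equalizer f g i ->
  cod k = dom i -> cod k' = dom i -> i ∘ k = i ∘ k' -> k = k'.
Proof.
move=> [[d c] ci e u] dk dk' ek.
have cq : dom (i ∘ k) = dom k by rewrite dom_mcomp.
have cq' : dom (i ∘ k) = dom k' by rewrite ek dom_mcomp.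
case: (u (i ∘ k)) => [||x [_ ux]].
- by rewrite cod_mcomp.
- by rewrite !mcompA // ?e // -?d ?ci.
by rewrite -(ux k) ?(ux k') //; do !split; rewrite ?cq ?cq'.
Qed.

Lemma descP f g q h : is_coequalizer f g q -> dom h = cod f ->
  h ∘ f = h ∘ g -> arrow (cod q) (cod h) (desc q h) /\ desc q h ∘ q = h.
Proof.
move=> [_ _ _ u] dh eh; case: (u h dh eh) => k [hk _].
exact: (epsilon_spec (inhabits h)
  (fun k => arrow (cod q) (cod h) k /\ k ∘ q = h) (ex_intro _ k hk)).
Qed.

Lemma factP f g i h : is_equalizer f g i -> cod h = dom f ->
  f ∘ h = g ∘ h -> arrow (dom h) (dom i) (fact i h) /\ i ∘ fact i h = h.
Proof.
move=> [_ _ _ u] dh eh; case: (u h dh eh) => k [hk _].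
exact: (epsilon_spec (inhabits h)
  (fun k => arrow (dom h) (dom i) k /\ i ∘ k = h) (ex_intro _ k hk)).
Qed.

End Arrows.

Lemma equalizerP (V : base_category) (f g : mor V) :
  parallel f g -> is_equalizer f g (equalizer f g).
Proof. by move=> /has_equalizers; exact: epsilon_spec. Qed.

Lemma coequalizerP (V : base_category) (f g : mor V) :
  parallel f g -> is_coequalizer f g (coequalizer f g).
Proof. by move=> /has_coequalizers; exact: epsilon_spec. Qed.

Section Typing.
Context {V : base_category}.

Lemma dom_unt (A : algebra V) : dom (unt A) = munit.
Proof. by case: (unt_arrow A). Qed.
Lemma cod_unt (A : algebra V) : cod (unt A) = A.
Proof. by case: (unt_arrow A). Qed.
Lemma dom_mul (A : algebra V) : dom (mul A) = A ⊠ A.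
Proof. by case: (mul_arrow A). Qed.
Lemma cod_mul (A : algebra V) : cod (mul A) = A.
Proof. by case: (mul_arrow A). Qed.
Lemma dom_cou (C : coalg V) : dom (cou C) = C.
Proof. by case: (cou_arrow C). Qed.
Lemma cod_cou (C : coalg V) : cod (cou C) = munit.
Proof. by case: (cou_arrow C). Qed.
Lemma dom_com (C : coalg V) : dom (com C) = C.
Proof. by case: (com_arrow C). Qed.
Lemma cod_com (C : coalg V) : cod (com C) = C ⊠ C.
Proof. by case: (com_arrow C). Qed.
Lemma dom_ahom (B A : algebra V) (i : algebra_hom B A) : dom i = B.
Proof. by case: (ahom_arrow i). Qed.
Lemma cod_ahom (B A : algebra V) (i : algebra_hom B A) : cod i = A.
Proof. by case: (ahom_arrow i). Qed.
Lemma dom_ract (B : algebra V) (X : rmodule B) : dom (ract X) = X ⊠ B.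
Proof. by case: (ract_arrow X). Qed.
Lemma cod_ract (B : algebra V) (X : rmodule B) : cod (ract X) = X.
Proof. by case: (ract_arrow X). Qed.
Lemma dom_lact (B : algebra V) (N : lmodule B) : dom (lact N) = B ⊠ N.
Proof. by case: (lact_arrow N). Qed.
Lemma cod_lact (B : algebra V) (N : lmodule B) : cod (lact N) = N.
Proof. by case: (lact_arrow N). Qed.
Lemma dom_ent (C : coalg V) (A : algebra V) (lam : entwining C A) :
  dom lam = C ⊠ A.
Proof. by case: (ent_arrow lam). Qed.
Lemma cod_ent (C : coalg V) (A : algebra V) (lam : entwining C A) :
  cod lam = A ⊠ C.
Proof. by case: (ent_arrow lam). Qed.
Lemma dom_gl (C : coalg V) (g : grouplike C) : dom g = munit.
Proof. by case: (gl_arrow g). Qed.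
Lemma cod_gl (C : coalg V) (g : grouplike C) : cod g = C.
Proof. by case: (gl_arrow g). Qed.
Lemma dom_coact (C : coalg V) (A : algebra V) (lam : entwining C A)
  (X : entwined_module lam) : dom (coact X) = X.
Proof. by case: (coact_arrow X). Qed.
Lemma cod_coact (C : coalg V) (A : algebra V) (lam : entwining C A)
  (X : entwined_module lam) : cod (coact X) = X ⊠ C.
Proof. by case: (coact_arrow X). Qed.

End Typing.

Create HintDb arr discriminated.
Hint Rewrite @dom_idm @cod_idm @dom_tmor @cod_tmor
  @dom_unt @cod_unt @dom_mul @cod_mul @dom_cou @cod_cou @dom_com @cod_com
  @dom_ahom @cod_ahom @dom_ract @cod_ract @dom_lact @cod_lact
  @dom_ent @cod_ent @dom_gl @cod_gl @dom_coact @cod_coact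
  @tobA @tob1l @tob1r : arr.

(* Decides equations between domains and codomains. *)
Ltac ty :=
  repeat match goal with
  | H : arrow _ _ _ |- _ => case: H => ? ?
  | H : module_map _ _ _ |- _ => case: H => ? ?
  end;
  repeat first
  [ reflexivity
  | progress autorewrite with arr
  | match goal with H : dom ?f = _ |- context [dom ?f] => rewrite H end
  | match goal with H : cod ?f = _ |- context [cod ?f] => rewrite H end
  | rewrite dom_mcomp; [|solve [ty]]
  | rewrite cod_mcomp; [|solve [ty]] ].

Tactic Notation "rw" uconstr(l) := rewrite l; try solve [ty].
Tactic Notation "rwr" uconstr(l) := rewrite -l; try solve [ty].

Ltac nrm :=
  repeat first
  [ rewrite idm_tob | rewrite tmor1l | rewrite tmor1r | rewrite tmorA
  | rewrite idl; [|solve [ty]] | rewrite idr; [|solve [ty]]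
  | rewrite idl2; [|solve [ty]] | rewrite idr2; [|solve [ty]]
  | rewrite idl3; [|solve [ty]] | rewrite idr3; [|solve [ty]] ].

Section Whisker.
Context {V : strict_monoidal}.
Implicit Types (X Y Z : ob V) (f g h k q : mor V).

Lemma wl X g f : dom g = cod f -> X ⊗ (g ∘ f) = (X ⊗ g) ∘ (X ⊗ f).
Proof. by move=> e; rewrite tcomp ?idl // ?dom_idm ?cod_idm. Qed.

Lemma wr X g f : dom g = cod f -> (g ∘ f) ⊗ X = (g ⊗ X) ∘ (f ⊗ X).
Proof. by move=> e; rewrite tcomp ?idl // ?dom_idm ?cod_idm. Qed.

Lemma slidel X Y f g : dom f = X -> cod g = Y -> (f ⊗ Y) ∘ (X ⊗ g) = f ⊗ g.
Proof. by move=> <- <-; rewrite tcomp ?dom_idm ?cod_idm // idl // idr. Qed.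

Lemma slider X Y f g : cod f = X -> dom g = Y -> (X ⊗ g) ∘ (f ⊗ Y) = f ⊗ g.
Proof. by move=> <- <-; rewrite tcomp ?dom_idm ?cod_idm // idl // idr. Qed.

Lemma slidel1 Y f g : dom f = munit -> cod g = Y -> (f ⊗ Y) ∘ g = f ⊗ g.
Proof. by move=> df <-; rewrite -{2}[g]tmor1l slidel. Qed.

Lemma slider1 X f g : cod f = X -> dom g = munit -> (X ⊗ g) ∘ f = f ⊗ g.
Proof. by move=> <- dg; rewrite -{2}[f]tmor1r slider. Qed.

End Whisker.

(* Right-associates compositions. *)
Ltac ra := repeat (rewrite acomp; [|solve [ty]|solve [ty]]).

Section Elements.
Context {V : base_category}.

Lemma mul1le (A : algebra V) f : cod f = A -> mul A ∘ (unt A ⊗ f) = f.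
Proof.
move=> hf; rewrite -{1}(tmor1l f) -(@slidel _ munit A); try ty.
by rw mcompA; rewrite mul1l; nrm.
Qed.

Lemma mul1re (A : algebra V) f : cod f = A -> mul A ∘ (f ⊗ unt A) = f.
Proof.
move=> hf; rewrite -{1}(tmor1r f) -(@slider _ A munit); try ty.
by rw mcompA; rewrite mul1r; nrm.
Qed.

Lemma mulAe (A : algebra V) f g h : cod f = A -> cod g = A -> cod h = A ->
  mul A ∘ ((mul A ∘ (f ⊗ g)) ⊗ h) = mul A ∘ (f ⊗ (mul A ∘ (g ⊗ h))).
Proof.
move=> hf hg hh.
have -> : (mul A ∘ (f ⊗ g)) ⊗ h = (mul A ⊗ A) ∘ (f ⊗ g ⊗ h) by rw tcomp; nrm.
have -> : f ⊗ (mul A ∘ (g ⊗ h)) = (A ⊗ mul A) ∘ (f ⊗ g ⊗ h).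
  by rewrite -tmorA; rw tcomp; nrm.
by rw mcompA; rewrite mulA; rw acomp.
Qed.

Lemma ract1e (B : algebra V) (X : rmodule B) f : cod f = X ->
  ract X ∘ (f ⊗ unt B) = f.
Proof.
move=> hf; rewrite -{1}(tmor1r f) -(@slider _ X munit); try ty.
by rw mcompA; rewrite ract1; nrm.
Qed.

Lemma ractAe (B : algebra V) (X : rmodule B) f g h :
  cod f = X -> cod g = B -> cod h = B ->
  ract X ∘ ((ract X ∘ (f ⊗ g)) ⊗ h) = ract X ∘ (f ⊗ (mul B ∘ (g ⊗ h))).
Proof.
move=> hf hg hh.
have -> : (ract X ∘ (f ⊗ g)) ⊗ h = (ract X ⊗ B) ∘ (f ⊗ g ⊗ h) by rw tcomp; nrm.
have -> : f ⊗ (mul B ∘ (g ⊗ h)) = (X ⊗ mul B) ∘ (f ⊗ g ⊗ h).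
  by rewrite -tmorA; rw tcomp; nrm.
by rw mcompA; rewrite ractA; rw acomp.
Qed.

End Elements.

Section Extension.
Context {V : base_category}.

Lemma module_map1 (B : algebra V) (X : rmodule B) : module_map X X X.
Proof. by split; [split; ty | nrm]. Qed.

Lemma module_mapM (B : algebra V) (X Y Z : rmodule B) g f :
  module_map Y Z g -> module_map X Y f -> module_map X Z (g ∘ f).
Proof.
move=> [[dg cg] hg] [[df cf] hf]; split; first by split; ty.
by rw wr; rw acomp; rewrite hf; rw mcompA; rewrite hg; ra.
Qed.

Definition rmodule_cat (B : algebra V) : category.
Proof.
refine (@Category (rmodule B) (fun X Y => {f | module_map X Y f})
  (fun X => exist _ _ (module_map1 X))
  (fun X Y Z g f => exist _ _ (module_mapM (proj2_sig g) (proj2_sig f)))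
  _ _ _).
- move=> X Y Z T [h hh] [g hg] [f hf]; apply: sig_inj => /=; rw mcompA.
- move=> X Y [f hf]; apply: sig_inj => /=; rw idl.
- move=> X Y [f hf]; apply: sig_inj => /=; rw idr.
Defined.

(* The tensor product X ⊗_B N: the projection X ⊗ N -> X ⊗_B N. *)
Definition tensor_proj (B : algebra V) (X : rmodule B) (N : lmodule B) : mor V :=
  coequalizer (ract X ⊗ N) (X ⊗ lact N).

Lemma tensor_projP (B : algebra V) (X : rmodule B) (N : lmodule B) :
  is_coequalizer (ract X ⊗ N) (X ⊗ lact N) (tensor_proj X N).
Proof. by apply: coequalizerP; split; ty. Qed.

Lemma dom_proj (B : algebra V) (X : rmodule B) (N : lmodule B) :
  dom (tensor_proj X N) = X ⊠ N.
Proof. by case: (tensor_projP X N) => _ -> *; ty. Qed.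
Hint Rewrite @dom_proj : arr.

Definition tensor_over (B : algebra V) (X : rmodule B) (N : lmodule B) : ob V :=
  cod (tensor_proj X N).

Lemma cod_proj (B : algebra V) (X : rmodule B) (N : lmodule B) :
  cod (tensor_proj X N) = tensor_over X N.
Proof. by []. Qed.
Hint Rewrite @cod_proj : arr.

Lemma tensor_proj_epi (B : algebra V) (X : rmodule B) (N : lmodule B) k k' :
  dom k = tensor_over X N -> dom k' = tensor_over X N ->
  k ∘ tensor_proj X N = k' ∘ tensor_proj X N -> k = k'.
Proof. exact: coequalizer_epi (tensor_projP X N). Qed.

Lemma tensor_projr_epi (B : algebra V) (X : rmodule B) (N : lmodule B) Z k k' :
  dom k = tensor_over X N ⊠ Z -> dom k' = tensor_over X N ⊠ Z ->
  k ∘ (tensor_proj X N ⊗ Z) = k' ∘ (tensor_proj X N ⊗ Z) -> k = k'.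
Proof.
move=> hk hk'; apply:
  (coequalizer_epi (tensor_coequalizerr Z (tensor_projP X N))).
  by rewrite hk; ty.
by rewrite hk'; ty.
Qed.

Definition regular_rmodule (A : algebra V) : rmodule A :=
  @RModule V A A (mul A) (mul_arrow A) (mul1r A) (mulA A).

Context (B A : algebra V) (i : algebra_hom B A).

Lemma ahomMe f g : cod f = B -> cod g = B ->
  i ∘ (mul B ∘ (f ⊗ g)) = mul A ∘ ((i ∘ f) ⊗ (i ∘ g)).
Proof.
by move=> hf hg; rw mcompA; rewrite ahomM; ra; rw tcomp.
Qed.

Section RestrModule.
Context (Y : rmodule A).
Local Notation xi := (ract Y ∘ (Y ⊗ i)).

Lemma restr_ract_arrow : arrow (Y ⊠ B) Y xi.
Proof. by split; ty. Qed.

Lemma restr_ract1 : xi ∘ (Y ⊗ unt B) = Y.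
Proof. by ra; rw tcomp; rewrite ahom1 ract1e; nrm; ty. Qed.

Lemma restr_ractA : xi ∘ (xi ⊗ B) = xi ∘ (Y ⊗ mul B).
Proof.
ra; rw tcomp; nrm; rw ractAe; rewrite tcomp; try solve [ty].
  by rewrite ahomM; nrm.
Qed.

Definition restr_rmodule : rmodule B :=
  @RModule V B Y (ract Y ∘ (Y ⊗ i)) restr_ract_arrow restr_ract1 restr_ractA.

End RestrModule.

Local Notation l := (mul A ∘ (i ⊗ A)).

Lemma restr_lact_arrow : arrow (B ⊠ A) A l.
Proof. by split; ty. Qed.

Lemma restr_lact1 : l ∘ (unt B ⊗ A) = A.
Proof. by ra; rw tcomp; rewrite ahom1 mul1le; nrm; ty. Qed.

Lemma restr_lactA : l ∘ (B ⊗ l) = l ∘ (mul B ⊗ A).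
Proof.
ra; rw tcomp; nrm; rw (@tcomp _ i); nrm; rewrite ahomM.
  rw mulAe.
Qed.

Definition restr_lmodule : lmodule B :=
  @LModule V B A (mul A ∘ (i ⊗ A)) restr_lact_arrow restr_lact1 restr_lactA.

Lemma restr_lmodule_ob : lm_ob restr_lmodule = A. Proof. by []. Qed.
Lemma restr_rmodule_ob (Y : rmodule A) : rm_ob (restr_rmodule Y) = Y.
Proof. by []. Qed.
Hint Rewrite restr_lmodule_ob restr_rmodule_ob : arr.

Lemma restr_map (X Y : rmodule A) f :
  module_map X Y f -> module_map (restr_rmodule X) (restr_rmodule Y) f.
Proof.
move=> [[df cf] hf]; split; first by split.
rewrite /=; rw mcompA; rewrite hf; ra; congr (_ ∘ _).
by rw tcomp; nrm; rw tcomp; nrm.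
Qed.

Definition restriction : functor (rmodule_cat A) (rmodule_cat B).
Proof.
refine (@Functor (rmodule_cat A) (rmodule_cat B) restr_rmodule
  (fun X Y f => exist _ _ (restr_map (proj2_sig f))) _ _).
- by move=> X; apply: sig_inj.
- by move=> X Y Z g f; apply: sig_inj.
Defined.

Section ExtObj.
Context (X : rmodule B).
Local Notation p := (tensor_proj X restr_lmodule).
Local Notation XA := (tensor_over X restr_lmodule).

Lemma proj_bal f b a : cod f = X -> cod b = B -> cod a = A ->
  p ∘ ((ract X ∘ (f ⊗ b)) ⊗ a) = p ∘ (f ⊗ (mul A ∘ ((i ∘ b) ⊗ a))).
Proof.
move=> hf hb ha; case: (tensor_projP X restr_lmodule) => _ dq e _.
have -> : (ract X ∘ (f ⊗ b)) ⊗ a = (ract X ⊗ A) ∘ (f ⊗ b ⊗ a).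
  by rw tcomp; nrm.
rw mcompA; rewrite e; ra; congr (_ ∘ _); rewrite -tmorA; rw tcomp.
by rewrite /=; ra; rw tcomp; nrm.
Qed.

(* h : X ⊗ A -> Z factors through X ⊗_B A *)
Definition balanced h : Prop :=
  dom h = X ⊠ A /\ h ∘ (ract X ⊗ A) = h ∘ (X ⊗ (mul A ∘ (i ⊗ A))).

Lemma balancedP h : balanced h ->
  arrow XA (cod h) (desc p h) /\ desc p h ∘ p = h.
Proof.
by move=> [dh e]; apply: (descP (tensor_projP X restr_lmodule)) => //; ty.
Qed.

Lemma balancedrP Z h : dom h = X ⊠ A ⊠ Z ->
  h ∘ (ract X ⊗ A ⊗ Z) = h ∘ (X ⊗ (mul A ∘ (i ⊗ A)) ⊗ Z) ->
  arrow (XA ⊠ Z) (cod h) (desc (p ⊗ Z) h) /\ desc (p ⊗ Z) h ∘ (p ⊗ Z) = h.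
Proof.
move=> dh e; have P := tensor_coequalizerr Z (tensor_projP X restr_lmodule).
have -> : XA ⊠ Z = cod (p ⊗ Z) by ty.
by apply: (descP P) => //; ty.
Qed.

(* X ⊗_B m_A, on the coequalizer (X ⊗_B A) ⊗ A = X ⊗_B (A ⊗ A) *)
Definition ext_act : mor V := desc (p ⊗ A) (p ∘ (X ⊗ mul A)).

Lemma ext_actP : arrow (XA ⊠ A) XA ext_act /\
  ext_act ∘ (p ⊗ A) = p ∘ (X ⊗ mul A).
Proof.
have := @balancedrP A (p ∘ (X ⊗ mul A)).
rw cod_mcomp; apply; first by ty.
rewrite -!tmorA /=; ra; rw tcomp; rw tcomp; nrm; rw wr; nrm.
have -> : ract X ⊗ mul A = (ract X ∘ (X ⊗ B)) ⊗ mul A by nrm.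
rw proj_bal; nrm; congr (_ ∘ (_ ⊗ _)).
rw (@mcompA _ _ (mul A ⊗ A)); rewrite mulA; ra; rewrite -tmorA.
by rw tcomp; nrm.
Qed.

Lemma dom_ext_act : dom ext_act = XA ⊠ A. Proof. by case: ext_actP; case. Qed.
Lemma cod_ext_act : cod ext_act = XA. Proof. by case: ext_actP; case. Qed.
Hint Rewrite dom_ext_act cod_ext_act : arr.

Lemma ext_acte f a b : cod f = X -> cod a = A -> cod b = A ->
  ext_act ∘ ((p ∘ (f ⊗ a)) ⊗ b) = p ∘ (f ⊗ (mul A ∘ (a ⊗ b))).
Proof.
move=> hf ha hb.
have -> : (p ∘ (f ⊗ a)) ⊗ b = (p ⊗ A) ∘ (f ⊗ a ⊗ b) by rw tcomp; nrm.
rw mcompA; rewrite (proj2 ext_actP); ra; congr (_ ∘ _).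
by rewrite -tmorA; rw tcomp; nrm.
Qed.

Lemma ext_act1 : ext_act ∘ (XA ⊗ unt A) = XA.
Proof.
apply: (@tensor_proj_epi _ X restr_lmodule); try solve [ty].
  ra; rw slider1; nrm; rewrite -{1}(@idr2 _ X A p); last by ty.
  by rw ext_acte; rw mul1re; nrm.
Qed.

Lemma ext_actA : ext_act ∘ (ext_act ⊗ A) = ext_act ∘ (XA ⊗ mul A).
Proof.
apply: (@tensor_projr_epi _ X restr_lmodule (A ⊠ A)); try solve [ty].
  ra; rw slider; rewrite idm_tob tmorA; rw tcomp; nrm.
  have -> : p ⊗ mul A = (p ⊗ A) ∘ (X ⊗ A ⊗ mul A) by rw tcomp; nrm.
  rw (@mcompA _ _ (p ⊗ A)); rewrite (proj2 ext_actP).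
  rw ext_acte; rewrite mulA; ra; congr (_ ∘ _).
  by rewrite -tmorA; rw tcomp; nrm.
Qed.

Definition extension_obj : rmodule A :=
  @RModule V A XA ext_act (proj1 ext_actP) ext_act1 ext_actA.

End ExtObj.
Local Notation p X := (tensor_proj X restr_lmodule).
Local Notation tA X := (tensor_over X restr_lmodule).
Hint Rewrite dom_ext_act cod_ext_act : arr.

Lemma extension_ob (X : rmodule B) : rm_ob (extension_obj X) = tA X.
Proof. by []. Qed.
Hint Rewrite extension_ob : arr.

(* The arrow f ⊗_B A : X ⊗_B A -> Y ⊗_B A *)
Definition ext_map (X Y : rmodule B) f : mor V := desc (p X) (p Y ∘ (f ⊗ A)).

Lemma ext_mapP (X Y : rmodule B) f : module_map X Y f ->
  arrow (tA X) (tA Y) (ext_map X Y f) /\ ext_map X Y f ∘ p X = p Y ∘ (f ⊗ A).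
Proof.
move=> [[df cf] hf]; have := @balancedP X (p Y ∘ (f ⊗ A)).
rw cod_mcomp; apply; split; first by ty.
ra; rwr wr; rewrite hf; rw slidel; rw proj_bal; congr (_ ∘ _).
by nrm.
Qed.

Lemma ext_map_module (X Y : rmodule B) f : module_map X Y f ->
  module_map (extension_obj X) (extension_obj Y) (ext_map X Y f).
Proof.
move=> hf; have [h e] := ext_mapP hf; split=> //.
apply: (@tensor_projr_epi _ X restr_lmodule A); try solve [ty].
rewrite /=; ra; rewrite (proj2 (ext_actP X)); rwr wr; rewrite e.
case: hf => [[df cf] hf].
by rw ext_acte; rw mcompA; rewrite e; ra; rw slidel; nrm.
Qed.

Lemma ext_map1 (X : rmodule B) : ext_map X X X = tA X.
Proof.
have [h e] := ext_mapP (module_map1 X).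
apply: (@tensor_proj_epi _ X restr_lmodule); try solve [ty].
by rewrite e; nrm.
Qed.

Lemma ext_mapM (X Y Z : rmodule B) g f :
  module_map Y Z g -> module_map X Y f ->
  ext_map X Z (g ∘ f) = ext_map Y Z g ∘ ext_map X Y f.
Proof.
move=> hg hf; have [h e] := ext_mapP (module_mapM hg hf).
have [h1 e1] := ext_mapP hf; have [h2 e2] := ext_mapP hg.
apply: (@tensor_proj_epi _ X restr_lmodule); try solve [ty].
rewrite e; case: hg => [[dg cg] _]; case: hf => [[df cf] _].
by ra; rewrite e1; rw mcompA; rewrite e2; ra; rwr wr.
Qed.

Definition extension : functor (rmodule_cat B) (rmodule_cat A).
Proof.
refine (@Functor (rmodule_cat B) (rmodule_cat A) extension_obj
  (fun X Y f => exist _ _ (ext_map_module (proj2_sig f))) _ _).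
- by move=> X; apply: sig_inj; exact: ext_map1.
- move=> X Y Z g f; apply: sig_inj.
  exact: ext_mapM (proj2_sig g) (proj2_sig f).
Defined.

Definition ext_unit (X : rmodule B) : mor V := p X ∘ (X ⊗ unt A).

Lemma ext_unit_map (X : rmodule B) :
  module_map X (restr_rmodule (extension_obj X)) (ext_unit X).
Proof.
rewrite /ext_unit; split; first by split; ty.
rewrite /=; ra; rw slider1; rw slider; rw ext_acte; rw mul1le.
have -> : ract X ⊗ unt A = (ract X ∘ (X ⊗ B)) ⊗ unt A by nrm.
by rw proj_bal; nrm; rw mul1re.
Qed.

Definition ext_counit (Y : rmodule A) : mor V :=
  desc (p (restr_rmodule Y)) (ract Y).

Lemma ext_counitP (Y : rmodule A) :
  arrow (tA (restr_rmodule Y)) Y (ext_counit Y) /\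
  ext_counit Y ∘ p (restr_rmodule Y) = ract Y.
Proof.
have := @balancedP (restr_rmodule Y) (ract Y).
rw cod_ract; apply; split; first by ty.
by rewrite /=; rw ractAe; nrm.
Qed.

Lemma ext_counit_map (Y : rmodule A) :
  module_map (extension_obj (restr_rmodule Y)) Y (ext_counit Y).
Proof.
have [h e] := ext_counitP Y; split=> //.
apply: (@tensor_projr_epi _ (restr_rmodule Y) restr_lmodule A); try solve [ty].
rewrite /=; ra; rewrite (proj2 (ext_actP _)) -wr; try solve [ty].
by rewrite e ractA; rw mcompA; rewrite e.
Qed.

Definition ext_restr_adjunction : adjunction extension restriction.
Proof.
refine (@Adjunction _ _ extension restriction
  (fun X => exist _ _ (ext_unit_map X))
  (fun Y => exist _ _ (ext_counit_map Y)) _ _ _ _).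
- move=> X Y [f hf]; apply: sig_inj => /=.
  have [h e] := ext_mapP hf; case: hf => [[df cf] _].
  rewrite /ext_unit; rw (@mcompA _ (ext_map X Y f)); rewrite e; ra.
  by rw slidel; rw slider1.
- move=> X Y [f hf]; apply: sig_inj => /=.
  have [h e] := ext_mapP (restr_map hf).
  have [hX eX] := ext_counitP X; have [hY eY] := ext_counitP Y.
  case: hf => [[df cf] hf].
  apply: (@tensor_proj_epi _ (restr_rmodule X) restr_lmodule); try solve [ty].
  by ra; rewrite e eX; rw mcompA; rewrite eY hf.
- move=> X; apply: sig_inj => /=.
  have [h e] := ext_mapP (ext_unit_map X).
  have [hY eY] := ext_counitP (extension_obj X).
  apply: (@tensor_proj_epi _ X restr_lmodule); try solve [ty].
  ra; rewrite e; rw mcompA; rewrite eY /ext_unit /=; rw ext_acte.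
  by rw mul1le; nrm.
- move=> Y; apply: sig_inj => /=.
  have [hY eY] := ext_counitP Y.
  by rewrite /ext_unit; rw mcompA; rewrite eY /= ract1.
Defined.

End Extension.

Section EntwinedCategory.
Context {V : base_category} (C : coalg V) (A : algebra V).
Context (lam : entwining C A).

Definition entwined_map (X Y : entwined_module lam) f : Prop :=
  module_map X Y f /\ comodule_map X Y f.

Lemma entwined_map1 (X : entwined_module lam) : entwined_map X X X.
Proof. by split; [exact: module_map1 | rewrite /comodule_map; nrm]. Qed.

Lemma entwined_mapM (X Y Z : entwined_module lam) g f :
  entwined_map Y Z g -> entwined_map X Y f -> entwined_map X Z (g ∘ f).
Proof.
move=> [hg eg] [hf ef]; split; first exact: module_mapM hg hf.
case: hg => [[dg cg] _]; case: hf => [[df cf] _].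
by rewrite /comodule_map; rw wr; rw mcompA; rewrite eg; ra; rewrite ef.
Qed.

Definition entwined_cat : category.
Proof.
refine (@Category (entwined_module lam) (fun X Y => {f | entwined_map X Y f})
  (fun X => exist _ _ (entwined_map1 X))
  (fun X Y Z g f => exist _ _ (entwined_mapM (proj2_sig g) (proj2_sig f)))
  _ _ _).
- move=> X Y Z T [h [hh eh]] [g [hg eg]] [f [hf ef]]; apply: sig_inj => /=.
  rw mcompA.
- move=> X Y [f [hf ef]]; apply: sig_inj => /=; rw idl.
- move=> X Y [f [hf ef]]; apply: sig_inj => /=; rw idr.
Defined.

End EntwinedCategory.

Section Entwined.
Context {V : base_category} (C : coalg V) (A : algebra V).
Context (lam : entwining C A) (g : grouplike C).

Definition g_A : mor V := lam ∘ (g ⊗ A).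

Lemma dom_gA : dom g_A = A. Proof. rewrite /g_A; ty. Qed.
Lemma cod_gA : cod g_A = A ⊠ C. Proof. rewrite /g_A; ty. Qed.
Hint Rewrite dom_gA cod_gA : arr.

Lemma gA_unt : g_A ∘ unt A = unt A ⊗ g.
Proof.
rewrite /g_A; ra.
have -> : (g ⊗ A) ∘ unt A = (C ⊗ unt A) ∘ g.
  rewrite -{1}(tmor1l (unt A)) -{2}(tmor1r g).
  by rewrite slidel ?slider; try ty.
rw mcompA; rewrite ent_unt -{1}(tmor1l g); rewrite slidel; try ty.
Qed.

Lemma gA_mul : g_A ∘ mul A = (mul A ⊗ C) ∘ ((A ⊗ lam) ∘ (g_A ⊗ A)).
Proof.
rewrite /g_A; ra.
have -> : (g ⊗ A) ∘ mul A = (C ⊗ mul A) ∘ (g ⊗ (A ⊠ A)).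
  by rewrite -{1}(tmor1l (mul A)) slidel ?slider; try ty.
rw mcompA; rewrite ent_mul; ra; rw wr; by nrm.
Qed.

Lemma gA_cou : (A ⊗ cou C) ∘ g_A = A.
Proof.
rewrite /g_A; rw mcompA; rewrite ent_cou; rwr wr.
by rewrite gl_cou tmor1l.
Qed.

Lemma gA_com : (g_A ⊗ C) ∘ g_A = (A ⊗ com C) ∘ g_A.
Proof.
rewrite {3}/g_A; rw (@mcompA _ (A ⊗ com C)); rewrite ent_com; ra.
rwr wr; rewrite gl_com {1}/g_A; rw wr; ra; congr (_ ∘ _).
have -> : (C ⊗ lam) ∘ (g ⊗ g ⊗ A) = g ⊗ g_A.
  by rewrite -tmorA /g_A; rw tcomp; nrm.
by rewrite -tmorA -idm_tob -{1}(tmor1l g_A) slidel; try ty.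
Qed.

Lemma parallel_gA : parallel g_A (A ⊗ g).
Proof. by split; ty. Qed.

(* i_A : A^C -> A *)
Definition coinv_incl : mor V := equalizer g_A (A ⊗ g).

Lemma coinv_inclP : is_equalizer g_A (A ⊗ g) coinv_incl.
Proof. exact: equalizerP parallel_gA. Qed.

Definition coinv_ob : ob V := dom coinv_incl.
Local Notation E := coinv_ob.
Local Notation i := coinv_incl.

Lemma dom_i : dom i = E. Proof. by []. Qed.
Lemma cod_i : cod i = A. Proof. by case: coinv_inclP => _ -> *; ty. Qed.
Hint Rewrite dom_i cod_i : arr.

Lemma gA_i : g_A ∘ i = i ⊗ g.
Proof.
case: coinv_inclP => _ _ -> _.
rewrite slider1; ty.
Qed.

Definition coinv_unt : mor V := fact i (unt A).
Definition coinv_mul : mor V := fact i (mul A ∘ (i ⊗ i)).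

Lemma coinv_untP : arrow munit E coinv_unt /\ i ∘ coinv_unt = unt A.
Proof.
rewrite -(dom_unt A); apply: (factP coinv_inclP); first by ty.
by rewrite gA_unt -{2}(tmor1r (unt A)) slider; try ty.
Qed.

Lemma gA_mul_i f : cod f = A ->
  g_A ∘ (mul A ∘ (i ⊗ f)) = (mul A ⊗ C) ∘ (i ⊗ (g_A ∘ f)).
Proof.
move=> hf; rw mcompA; rewrite gA_mul; ra; congr (_ ∘ _).
rw (@tcomp _ g_A); rewrite gA_i; nrm; rewrite -tmorA.
rw tcomp; rewrite /g_A; ra; nrm; congr (_ ⊗ (_ ∘ _)).
by rewrite -{2}(tmor1l f) slidel; try ty.
Qed.

Lemma coinv_mulP : arrow (E ⊠ E) E coinv_mul /\ i ∘ coinv_mul = mul A ∘ (i ⊗ i).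
Proof.
have <- : dom (mul A ∘ (i ⊗ i)) = E ⊠ E by ty.
apply: (factP coinv_inclP); first by ty.
rw gA_mul_i.
rewrite gA_i tmorA; rw tcomp; nrm.
by rewrite -[mul A ∘ _ in RHS]tmor1r slider; try ty.
Qed.

Lemma coinv_mul1l : coinv_mul ∘ (coinv_unt ⊗ E) = E.
Proof.
have [hu eu] := coinv_untP; have [hm em] := coinv_mulP.
apply: (equalizer_mono coinv_inclP); try solve [ty].
by rw mcompA; rewrite em; ra; rw tcomp; nrm; rewrite eu; rw mul1le.
Qed.

Lemma coinv_mul1r : coinv_mul ∘ (E ⊗ coinv_unt) = E.
Proof.
have [hu eu] := coinv_untP; have [hm em] := coinv_mulP.
apply: (equalizer_mono coinv_inclP); try solve [ty].
by rw mcompA; rewrite em; ra; rw tcomp; nrm; rewrite eu; rw mul1re.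
Qed.

Lemma coinv_mulA : coinv_mul ∘ (coinv_mul ⊗ E) = coinv_mul ∘ (E ⊗ coinv_mul).
Proof.
have [hm em] := coinv_mulP.
apply: (equalizer_mono coinv_inclP); try solve [ty].
rw mcompA; rewrite em; ra; rw tcomp; nrm.
rewrite em; rw mcompA; rewrite em; ra; rw tcomp; nrm; rewrite em.
by rw mulAe.
Qed.

Definition coinv_alg : algebra V :=
  @Algebra V E coinv_unt coinv_mul (proj1 coinv_untP) (proj1 coinv_mulP)
    coinv_mul1l coinv_mul1r coinv_mulA.

Definition coinv_hom : algebra_hom coinv_alg A.
Proof.
refine (@AlgebraHom V coinv_alg A i _ (proj2 coinv_untP) (proj2 coinv_mulP)).
by split; ty.
Defined.

Local Notation iA := coinv_hom.
Local Notation p X := (tensor_proj X (restr_lmodule iA)).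
Local Notation tA X := (tensor_over X (restr_lmodule iA)).
Hint Rewrite @dom_proj @cod_proj @restr_lmodule_ob @restr_rmodule_ob
  @dom_ext_act @cod_ext_act @extension_ob : arr.

Lemma gA_mul_coinv : g_A ∘ (mul A ∘ (iA ⊗ A)) = (mul A ⊗ C) ∘ (iA ⊗ g_A).
Proof. by rewrite /= gA_mul_i; nrm; ty. Qed.

(* X ⊗_{A^C} g_A, with values in (X ⊗_{A^C} A) ⊗ C = X ⊗_{A^C} (A ⊗ C) *)
Definition Fbar_coact (X : rmodule coinv_alg) : mor V :=
  desc (p X) ((p X ⊗ C) ∘ (X ⊗ g_A)).

Lemma Fbar_coactP (X : rmodule coinv_alg) :
  arrow (tA X) (tA X ⊠ C) (Fbar_coact X) /\
  Fbar_coact X ∘ p X = (p X ⊗ C) ∘ (X ⊗ g_A).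
Proof.
have := @balancedP _ _ _ iA X ((p X ⊗ C) ∘ (X ⊗ g_A)).
rw cod_mcomp; rewrite cod_tmor cod_proj cod_idm; apply; split; first by ty.
case: (tensor_projP X (restr_lmodule iA)) => _ _ e _.
ra; rw slider; rwr wl; rewrite gA_mul_coinv; rw wl; rewrite !tmorA.
rw mcompA; rwr wr.
have -> : ract X ⊗ g_A = (ract X ⊗ A ⊗ C) ∘ (X ⊗ coinv_alg ⊗ g_A).
  by rewrite -tmorA; rw tcomp; nrm.
rw (@mcompA _ (p X ⊗ C)); rwr wr; rewrite e /=.
have -> : X ⊗ i ⊗ g_A = (X ⊗ i ⊗ A ⊗ C) ∘ (X ⊗ E ⊗ g_A).
  by rewrite -!tmorA; rw tcomp; rw tcomp; nrm.
rw (@mcompA _ _ (X ⊗ i ⊗ A ⊗ C)); congr (_ ∘ _); rwr wr; congr (_ ⊗ _).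
by rw wl; rewrite tmorA; ra.
Qed.

Lemma dom_Fbar_coact (X : rmodule coinv_alg) : dom (Fbar_coact X) = tA X.
Proof. by case: (Fbar_coactP X) => [[]]. Qed.
Lemma cod_Fbar_coact (X : rmodule coinv_alg) : cod (Fbar_coact X) = tA X ⊠ C.
Proof. by case: (Fbar_coactP X) => [[]]. Qed.
Hint Rewrite dom_Fbar_coact cod_Fbar_coact : arr.

Lemma Fbar_coact1 (X : rmodule coinv_alg) :
  (tA X ⊗ cou C) ∘ Fbar_coact X = tA X.
Proof.
have e := proj2 (Fbar_coactP X).
apply: (@tensor_proj_epi _ _ X (restr_lmodule iA)); try solve [ty].
  ra; rewrite e; rw mcompA; rw slider.
  have -> : p X ⊗ cou C = p X ∘ (X ⊗ (A ⊗ cou C)).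
    by rewrite -[p X in RHS]tmor1r tmorA; rw tcomp; nrm.
  by ra; rwr wl; rewrite gA_cou; nrm.
Qed.

Lemma Fbar_coactA (X : rmodule coinv_alg) :
  (Fbar_coact X ⊗ C) ∘ Fbar_coact X = (tA X ⊗ com C) ∘ Fbar_coact X.
Proof.
have e := proj2 (Fbar_coactP X).
apply: (@tensor_proj_epi _ _ X (restr_lmodule iA)); try solve [ty].
  ra; rewrite e; rw (@mcompA _ (Fbar_coact X ⊗ C)); rwr wr; rewrite e.
  rw wr; ra; rewrite -[X ⊗ g_A ⊗ C]tmorA; rwr wl; rewrite gA_com.
  rw (@mcompA _ (_ ⊗ com C)); rw slider.
  have -> : p X ⊗ com C = (p X ⊗ C ⊗ C) ∘ (X ⊗ (A ⊗ com C)).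
    by rewrite tmorA -tmorA; rw tcomp; nrm.
  by ra; rwr wl.
Qed.

Lemma Fbar_coact_act (X : rmodule coinv_alg) :
  Fbar_coact X ∘ ext_act iA X
    = (ext_act iA X ⊗ C) ∘ (tA X ⊗ lam) ∘ (Fbar_coact X ⊗ A).
Proof.
have e := proj2 (Fbar_coactP X).
apply: (@tensor_projr_epi _ _ X (restr_lmodule iA) A); try solve [ty].
  have eA := proj2 (ext_actP iA X).
  ra; rewrite eA; rw (@mcompA _ (Fbar_coact X)); rewrite e; ra.
  rwr wl; rewrite gA_mul; rwr wr; rewrite e; rw wr; ra.
  have E1 : (tA X ⊗ lam) ∘ (p X ⊗ C ⊗ A) = (p X ⊗ A ⊗ C) ∘ (X ⊗ (A ⊗ lam)).
    by rewrite tmorA -!(tmorA (p X)); rw tcomp; rw tcomp; nrm.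
  rw (@mcompA _ _ (p X ⊗ C ⊗ A)); rewrite E1; ra.
  rw (@mcompA _ _ (p X ⊗ A ⊗ C)); rwr wr; rewrite eA; rw wr; ra.
  congr (_ ∘ _); rw wl; rw wl; rewrite !tmorA //.
Qed.

Definition Fbar_obj (X : rmodule coinv_alg) : entwined_module lam :=
  @EntwinedModule V C A lam (extension_obj iA X) (Fbar_coact X)
    (proj1 (Fbar_coactP X)) (Fbar_coact1 X) (Fbar_coactA X) (Fbar_coact_act X).

Lemma Fbar_map (X Y : rmodule coinv_alg) f : module_map X Y f ->
  entwined_map (Fbar_obj X) (Fbar_obj Y) (ext_map iA X Y f).
Proof.
move=> hf; split; first exact: ext_map_module.
have [h e] := ext_mapP iA hf.
have eX := proj2 (Fbar_coactP X); have eY := proj2 (Fbar_coactP Y).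
apply: (@tensor_proj_epi _ _ X (restr_lmodule iA)); try solve [ty].
rewrite /comodule_map /=; ra; rewrite e eX.
rw (@mcompA _ (Fbar_coact Y)); rewrite eY.
rw (@mcompA _ _ (p X ⊗ C)); rwr wr; rewrite e.
case: hf => [[df cf] _]; rw wr; ra; rw slider.
by rewrite -tmorA; rw (@tcomp _ f); nrm.
Qed.

Definition Fbar : functor (rmodule_cat coinv_alg) (entwined_cat lam).
Proof.
refine (@Functor (rmodule_cat coinv_alg) (entwined_cat lam) Fbar_obj
  (fun X Y f => exist _ _ (Fbar_map (proj2_sig f))) _ _).
- by move=> X; apply: sig_inj; exact: ext_map1.
- move=> X Y Z k f; apply: sig_inj.
  exact: ext_mapM (proj2_sig k) (proj2_sig f).
Defined.

(* A ⊗_{A^C} A -> A ⊗ C *)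
Definition can : mor V :=
  desc (p (restr_rmodule iA (regular_rmodule A)))
       ((mul A ⊗ C) ∘ (A ⊗ g_A)).

Lemma canP :
  arrow (tA (restr_rmodule iA (regular_rmodule A))) (A ⊠ C) can /\
  can ∘ p (restr_rmodule iA (regular_rmodule A)) = (mul A ⊗ C) ∘ (A ⊗ g_A).
Proof.
have := @balancedP _ _ _ iA (restr_rmodule iA (regular_rmodule A))
  ((mul A ⊗ C) ∘ (A ⊗ g_A)).
rw cod_mcomp; rewrite cod_tmor cod_mul cod_idm; apply; split; first by ty.
rewrite /=; ra; rw slider; rwr wl; rewrite gA_mul_coinv; rw wl; rewrite !tmorA.
rw mcompA; rwr wr; rewrite -mulA; rw wr; ra; congr (_ ∘ _).
by rewrite -[mul A ⊗ A ⊗ C]tmorA -idm_tob; rw tcomp; nrm.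
Qed.

(* An inverse in V of the A-coring morphism can is again one of A-corings. *)
Definition galois : Prop := is_iso can.

End Entwined.

(* Main.v *)
From mathcomp Require Import ssreflect ssrfun ssrbool.
From Stdlib Require Import ClassicalEpsilon.
Require Import Defs.

(** Let B = A^C, let F be extension of scalars along i_A and G restriction.
Entwined modules are the coalgebras of the comonad W = - ⊗ C on right
A-modules, where A acts on Y ⊗ C through λ.  Under this identification the
functor Fbar of the theorem is F together with a coaction c : F -> W F, whose
components are the arrows X ⊗_B g_A.  The theorem is thereby an instance of a
statement about an arbitrary adjunction F ⊣ G, an arbitrary comonad W on the
target of F and an arbitrary coaction c of W on F (lift_equivalence).

A coaction c amounts to a morphism of comonads t : F G -> W, where
t_Y = W(ε_Y) c_(G Y), and the lift of F to W-coalgebras is the comparison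
functor of F ⊣ G followed by the functor that composes structure arrows
with t (push_comparison).  If every t_Y is invertible, then this second functor
is an equivalence (push_equivalence), so that the lift is an equivalence
exactly when F is comonadic.

Conversely, let the lift be an equivalence.  An arrow from the lift of Z to the
cofree coalgebra W Y is the same as an arrow F Z -> Y, hence as an arrow
Z -> G Y, hence, by full faithfulness, as an arrow from the lift of Z to the
lift of G Y; the passage is composition with t_Y.  Thus t_Y has the unique
factorization property of an isomorphism with respect to all lifted coalgebras,
and the cofree coalgebra W Y is itself isomorphic to a lifted one.  So t_Y is
invertible (lift_can_invertible).

In the case at hand t_Y : Y ⊗_B A -> Y ⊗ C is induced by
(ξ_Y ⊗ C)(Y ⊗ g_A), and t_A = can (can_at_regular).  It remains to see that all
the t_Y are invertible as soon as can is.  Morally t_Y is Y ⊗_A can; the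
inverse is built without forming tensor products over A, from the arrow
Y ⊗ (A ⊗_B A) -> Y ⊗_B A induced by the action of A on Y (galois_can_at).  This
is where it matters that Y ⊗ - preserves coequalizers. *)

Set Implicit Arguments.
Unset Strict Implicit.
Unset Printing Implicit Defensive.

Local Open Scope cat_scope.

(** * Equivalences of categories *)

Section Equivalences.

Definition invertible (C : category) (X Y : C) (f : hom X Y) : Prop :=
  exists2 h : hom Y X, h • f = idc X & f • h = idc Y.

Definition faithful (C D : category) (F : functor C D) : Prop :=
  forall (X Y : C) (f f' : hom X Y), fmap F f = fmap F f' -> f = f'.

Definition full (C D : category) (F : functor C D) : Prop :=
  forall (X Y : C) (h : hom (F X) (F Y)), exists f, fmap F f = h.

Definition essentially_surjective (C D : category) (F : functor C D) : Prop :=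
  forall Y : D, exists (X : C) (f : hom (F X) Y), invertible f.

Lemma invertible_comp (C : category) (X Y Z : C) (k : hom Y Z) (f : hom X Y) :
  invertible k -> invertible f -> invertible (k • f).
Proof.
move=> [k' kl kr] [f' fl fr]; exists (f' • k').
- by rewrite -cmpA (cmpA k') kl cmp1l.
- by rewrite -cmpA (cmpA f) fr cmp1l.
Qed.

Lemma invertible_fmap (C D : category) (F : functor C D) (X Y : C)
  (f : hom X Y) : invertible f -> invertible (fmap F f).
Proof. by move=> [h hl hr]; exists (fmap F h); rewrite -fmapM ?hl ?hr fmap1. Qed.

Lemma invertible_mono (C : category) (X Y Z : C) (f : hom Y Z) (k k' : hom X Y) :
  invertible f -> f • k = f • k' -> k = k'.
Proof. by move=> [h hl _] e; rewrite -(cmp1l k) -hl -cmpA e cmpA hl cmp1l. Qed.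

Lemma nat_iso_sym (C D : category) (F G : functor C D) :
  naturally_isomorphic F G -> naturally_isomorphic G F.
Proof.
move=> [t [s [nt st ts]]]; exists s, t; split=> // X Y f.
by rewrite -[s Y • _]cmp1r -(ts X) cmpA -(cmpA (s Y)) -nt cmpA st cmp1l.
Qed.

Section Transport.
Context (C D : category) (F G : functor C D) (FG : naturally_isomorphic F G).

Lemma faithful_iso : faithful F -> faithful G.
Proof.
case: FG => t [s [nt st ts]] h X Y f f' e; apply: h.
by rewrite -[LHS]cmp1l -[RHS]cmp1l -(st Y) -!cmpA !nt e.
Qed.

Lemma full_iso : full F -> full G.
Proof.
case: FG => t [s [nt st ts]] hF X Y h.
have [f e] := hF X Y (s Y • (h • t X)); exists f.
by rewrite -[LHS]cmp1r -(ts X) cmpA -nt e -!cmpA ts cmp1r cmpA ts cmp1l.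
Qed.

Lemma essentially_surjective_iso :
  essentially_surjective F -> essentially_surjective G.
Proof.
case: FG => t [s [nt st ts]] hF Y; have [X [f hf]] := hF Y.
by exists X, (f • s X); apply: invertible_comp hf _; exists (t X).
Qed.

End Transport.

(** The inverse functor is built with the axiom of choice, so that being an
equivalence can be checked on arrows and on objects separately. *)
Lemma is_equivalenceP (C D : category) (F : functor C D) :
  is_equivalence F <-> [/\ faithful F, full F & essentially_surjective F].
Proof.
split.
  move=> [G [GF FG]].
  have id_faithful (E : category) : faithful (idF E) by move=> X Y f f'.
  (* G reflects equality, which turns fullness of G F into fullness of F *)
  have fG : faithful G.
    move=> X Y f f' e; apply: (faithful_iso (nat_iso_sym FG) (id_faithful D)).
    by rewrite /= e.
  split.
  - move=> X Y f f' e; apply: (faithful_iso (nat_iso_sym GF) (id_faithful C)).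
    by rewrite /= e.
  - have fullGF : full (compF G F).
      by apply: (full_iso (nat_iso_sym GF)) => X Y h; exists h.
    move=> X Y h; have [f e] := fullGF X Y (fmap G h).
    by exists f; apply: fG.
  - case: FG => t [s [_ st ts]] Y; exists (G Y), (t Y).
    by exists (s Y); [exact: st | exact: ts].
move=> [ffF fuF esF].
have pick Y : {X : C & {f : hom (F X) Y & {h : hom Y (F X) |
    h • f = idc _ /\ f • h = idc _}}}.
  have [X hX] := constructive_indefinite_description _ (esF Y).
  have [f hf] := constructive_indefinite_description _ hX.
  exists X, f; apply: constructive_indefinite_description.
  by case: hf => h hl hr; exists h.
pose o Y := projT1 (pick Y).
pose t Y : hom (F (o Y)) Y := projT1 (projT2 (pick Y)).
pose s Y : hom Y (F (o Y)) := proj1_sig (projT2 (projT2 (pick Y))).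
have st Y : s Y • t Y = idc _ := proj1 (proj2_sig (projT2 (projT2 (pick Y)))).
have ts Y : t Y • s Y = idc _ := proj2 (proj2_sig (projT2 (projT2 (pick Y)))).
pose lift X Y (h : hom (F X) (F Y)) : hom X Y :=
  proj1_sig (constructive_indefinite_description _ (fuF X Y h)).
have liftE X Y (h : hom (F X) (F Y)) : fmap F (lift X Y h) = h.
  exact: proj2_sig (constructive_indefinite_description _ (fuF X Y h)).
have gm1 X : lift _ _ (s X • (idc X • t X)) = idc (o X).
  by apply: ffF; rewrite liftE cmp1l st fmap1.
have gmM X Y Z (k : hom Y Z) (f : hom X Y) :
    lift _ _ (s Z • ((k • f) • t X))
      = lift _ _ (s Z • (k • t Y)) • lift _ _ (s Y • (f • t X)).
  by apply: ffF; rewrite fmapM !liftE -!cmpA (cmpA (t Y)) ts cmp1l.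
exists (@Functor D C o (fun X Y f => lift _ _ (s Y • (f • t X))) gm1 gmM).
split.
  exists (fun X => lift _ _ (t (F X))), (fun X => lift _ _ (s (F X))); split.
  - by move=> X Y f; apply: ffF; rewrite /= !fmapM !liftE cmpA ts cmp1l.
  - by move=> X; apply: ffF; rewrite fmapM !liftE st fmap1.
  - by move=> X; apply: ffF; rewrite fmapM !liftE ts fmap1.
exists t, s; split=> // X Y f.
by rewrite /= liftE cmpA ts cmp1l.
Qed.

(** One half of the two-out-of-three property.  The composite is given only up
to a natural isomorphism, because the two functors that are compared below
agree on objects up to an identity map between different records. *)
Lemma is_equivalence_cancel (C D E : category) (F : functor C D)
    (J : functor D E) (H : functor C E) :
  is_equivalence J -> naturally_isomorphic (compF J F) H ->
  is_equivalence F <-> is_equivalence H.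
Proof.
move=> /is_equivalenceP [fJ uJ eJ] JF; rewrite !is_equivalenceP.
split=> -[f u e]; split.
- by apply: (faithful_iso JF) => X Y k k' /fJ /f.
- apply: (full_iso JF) => X Y h.
  have [k <-] := uJ _ _ h; have [k' <-] := u _ _ k; by exists k'.
- apply: (essentially_surjective_iso JF) => Z.
  have [Y [k hk]] := eJ Z; have [X [k' hk']] := e Y.
  by exists X, (k • fmap J k'); apply: invertible_comp hk (invertible_fmap J hk').
- move=> X Y k k' ek; apply: (faithful_iso (nat_iso_sym JF) f).
  by rewrite /= ek.
- move=> X Y h.
  have [k ek] := full_iso (nat_iso_sym JF) u (fmap J h : hom (compF J F X) _).
  by exists k; apply: fJ.
- move=> Y.
  have [X [k [k' kl kr]]] :=
    essentially_surjective_iso (nat_iso_sym JF) e (J Y).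
  have [m em] := uJ _ _ (k : hom (J (F X)) _).
  have [m' em'] := uJ _ _ (k' : hom _ (J (F X))).
  exists X, m; exists m'; apply: fJ; rewrite fmapM fmap1 em em' //.
Qed.

End Equivalences.

(** * Change of comonad *)

Section ComonadMorphism.
Context (D : category) (T W : comonad D) (t : forall Y, hom (T Y) (W Y)).

Definition comonad_morphism : Prop :=
  [/\ natural (F := T) (G := W) t,
      forall Y, cmd_counit W Y • t Y = cmd_counit T Y
    & forall Y, cmd_comult W Y • t Y = fmap W (t Y) • (t (T Y) • cmd_comult T Y)].

Hypothesis tm : comonad_morphism.

Lemma push_counit (X : coalgebra T) :
  cmd_counit W (coa_obj X) • (t _ • coa_str X) = idc _.
Proof. by case: tm => nt te td; rewrite cmpA te coa_counit. Qed.

Lemma push_coassoc (X : coalgebra T) :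
  cmd_comult W (coa_obj X) • (t _ • coa_str X)
    = fmap W (t _ • coa_str X) • (t _ • coa_str X).
Proof.
case: tm => nt te td.
rewrite cmpA td -!cmpA coa_coassoc (cmpA (t (T X))) nt fmapM -!cmpA.
by rewrite (cmpA (fmap W (t X))).
Qed.

Definition push_coalgebra (X : coalgebra T) : coalgebra W :=
  Coalgebra (push_counit X) (push_coassoc X).

Lemma push_coalgebra_map (X Y : coalgebra T) (f : hom (coa_obj X) (coa_obj Y)) :
  coalgebra_map f ->
  coalgebra_map (X := push_coalgebra X) (Y := push_coalgebra Y) f.
Proof.
case: tm => nt te td; rewrite /coalgebra_map /= => e.
by rewrite -cmpA e cmpA nt -cmpA.
Qed.

Definition push : functor (coalgebra_cat T) (coalgebra_cat W).
Proof.
refine (@Functor (coalgebra_cat T) (coalgebra_cat W) push_coalgebra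
  (fun X Y f => exist _ _ (push_coalgebra_map (proj2_sig f))) _ _).
- by move=> X; apply: sig_inj.
- by move=> X Y Z g f; apply: sig_inj.
Defined.

(** Given a W-coalgebra (Y, w), the arrow t_Y^-1 w is a T-coalgebra structure:
coassociativity holds after composition with the invertible W(t_Y) t_(T Y). *)
Lemma push_equivalence : (forall Y, invertible (t Y)) -> is_equivalence push.
Proof.
case: (tm) => nt te td ti; apply/is_equivalenceP; split.
- by move=> X Y [f hf] [f' hf'] [e]; apply: sig_inj.
- move=> X Y [f hf]; have hf' : coalgebra_map (X := X) (Y := Y) f.
    apply: (invertible_mono (ti _)).
    by move: hf; rewrite /coalgebra_map /= => hf; rewrite cmpA hf (cmpA (t _)) nt -cmpA.
  by exists (exist _ _ hf'); apply: sig_inj.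
move=> Y; have [u hl hr] := ti Y; pose y := u • coa_str Y.
have ey : t Y • y = coa_str Y by rewrite /y cmpA hr cmp1l.
have y1 : cmd_counit T Y • y = idc _ by rewrite -te -cmpA ey coa_counit.
have yA : cmd_comult T Y • y = fmap T y • y.
  apply: (invertible_mono
    (invertible_comp (invertible_fmap W (ti Y)) (ti (T Y)))).
  rewrite cmpA -(cmpA (fmap W (t Y))) -td -cmpA ey coa_coassoc.
  by rewrite -cmpA (cmpA (t (T Y))) nt /= -!cmpA ey cmpA -fmapM ey.
have h : coalgebra_map (X := push_coalgebra (Coalgebra y1 yA)) (Y := Y) (idc _).
  by rewrite /coalgebra_map /= fmap1 cmp1l cmp1r ey.
have h' : coalgebra_map (X := Y) (Y := push_coalgebra (Coalgebra y1 yA)) (idc _).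
  by rewrite /coalgebra_map /= fmap1 cmp1l cmp1r ey.
exists (Coalgebra y1 yA), (exist _ _ h), (exist _ _ h');
  apply: sig_inj; exact: cmp1l.
Qed.

End ComonadMorphism.

(** * Lifting a left adjoint to coalgebras *)

Section Lift.
Context (C D : category) (F : functor C D) (G : functor D C).
Context (a : adjunction F G) (W : comonad D).
Context (c : forall X, hom (F X) (W (F X))).

Hypothesis c_nat : natural (F := F) (G := compF W F) c.
Hypothesis c_counit : forall X, cmd_counit W (F X) • c X = idc (F X).
Hypothesis c_coassoc :
  forall X, cmd_comult W (F X) • c X = fmap W (c X) • c X.

Definition lift_obj (X : C) : coalgebra W :=
  Coalgebra (c_counit X) (c_coassoc X).

Definition lift : functor C (coalgebra_cat W).
Proof.
refine (@Functor C (coalgebra_cat W) lift_obj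
  (fun X Y f => exist _ _ (c_nat f)) _ _).
- by move=> X; apply: sig_inj; exact: fmap1.
- by move=> X Y Z k f; apply: sig_inj; exact: fmapM.
Defined.

Local Notation T := (adj_comonad a).

(** The comonad morphism from F G to W that corresponds to the coaction c; for
entwined modules it is the canonical map. *)
Definition lift_can (Y : D) : hom (T Y) (W Y) :=
  fmap W (acounit a Y) • c (G Y).

(** On structure arrows, this identity says that the lift is the comparison
functor followed by change of comonad along lift_can. *)
Lemma lift_can_unit (X : C) : lift_can (F X) • fmap F (aunit a X) = c X.
Proof.
by rewrite /lift_can -cmpA c_nat /= cmpA -fmapM triangleF fmap1 cmp1l.
Qed.

(** This makes lift_can Y an arrow of coalgebras from the lift of G Y to the
cofree coalgebra on Y. *)
Lemma lift_can_coalgebra (Y : D) :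
  cmd_comult W Y • lift_can Y = fmap W (lift_can Y) • c (G Y).
Proof.
rewrite /lift_can cmpA (cmd_comult_nat W (acounit a Y)) /= fmapM -!cmpA.
by rewrite c_coassoc.
Qed.

Lemma lift_can_comonad_morphism : comonad_morphism (T := T) lift_can.
Proof.
split.
- move=> X Y f; rewrite /lift_can /= -cmpA c_nat /= cmpA -fmapM.
  by rewrite (acounit_nat a f) fmapM -cmpA.
- move=> Y; rewrite /lift_can cmpA (cmd_counit_nat W (acounit a Y)) /=.
  by rewrite -cmpA c_counit cmp1r.
- by move=> Y; rewrite lift_can_coalgebra lift_can_unit.
Qed.

Lemma push_comparison :
  naturally_isomorphic
    (compF (push lift_can_comonad_morphism) (comparison a)) lift.
Proof.
have h X : coalgebra_map (X := push_coalgebra lift_can_comonad_morphism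
    (comparison_obj a X)) (Y := lift_obj X) (idc _).
  by rewrite /coalgebra_map /= lift_can_unit fmap1 cmp1l cmp1r.
have h' X : coalgebra_map (X := lift_obj X)
    (Y := push_coalgebra lift_can_comonad_morphism (comparison_obj a X)) (idc _).
  by rewrite /coalgebra_map /= lift_can_unit fmap1 cmp1l cmp1r.
exists (fun X => exist _ _ (h X)), (fun X => exist _ _ (h' X)).
split=> [X Y f|X|X]; apply: sig_inj => /=; by rewrite ?cmp1l ?cmp1r.
Qed.

Definition cofree (Y : D) : coalgebra W.
Proof.
refine (@Coalgebra D W (W Y) (cmd_comult W Y) _ _).
- exact: cmd_counitl.
- exact: cmd_coassoc.
Defined.

(** An arrow into the cofree coalgebra on Y can thus be recovered from its
transpose, the composite with the counit at Y. *)
Lemma cofree_adjunct (X : coalgebra W) (Y : D) (f : hom (coa_obj X) (W Y)) :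
  coalgebra_map (X := X) (Y := cofree Y) f ->
  f = fmap W (cmd_counit W Y • f) • coa_str X.
Proof.
rewrite /coalgebra_map /= => e.
by rewrite fmapM -cmpA -e cmpA cmd_counitr cmp1l.
Qed.

(** Composition with lift_can Y is a bijection from the arrows between the lifts
of Z and of G Y to the arrows from the lift of Z to the cofree coalgebra on Y:
both correspond to arrows Z -> G Y, the former because the lift is full.  Taking
for Z an object whose lift is isomorphic to the cofree coalgebra gives a section
of lift_can Y, and taking Z = G Y shows that this section is an inverse. *)
Lemma lift_can_invertible :
  is_equivalence lift -> forall Y, invertible (lift_can Y).
Proof.
move=> /is_equivalenceP [_ fu es] Y.
have e1 Z (k : hom Z (G Y)) :
    cmd_counit W Y • (lift_can Y • fmap F k) = acounit a Y • fmap F k.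
  by case: lift_can_comonad_morphism => _ e _; rewrite cmpA e.
(* existence: the factor is the transpose of counit • f under F ⊣ G *)
have factor Z (f : hom (F Z) (W Y)) :
    coalgebra_map (X := lift_obj Z) (Y := cofree Y) f ->
    exists k : hom Z (G Y), lift_can Y • fmap F k = f.
  move=> hf; exists (fmap G (cmd_counit W Y • f) • aunit a Z).
  rewrite [RHS](cofree_adjunct hf) /lift_can -cmpA c_nat /= cmpA -fmapM.
  rewrite (fmapM F) (cmpA (acounit a Y)) (acounit_nat a) /= -cmpA.
  by rewrite triangleF cmp1r.
(* uniqueness: a coalgebra arrow is some F k by fullness, and k is the
   transpose of counit • (lift_can Y • F k) *)
have inj Z (f f' : hom (F Z) (F (G Y))) :
    coalgebra_map (X := lift_obj Z) (Y := lift_obj (G Y)) f ->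
    coalgebra_map (X := lift_obj Z) (Y := lift_obj (G Y)) f' ->
    lift_can Y • f = lift_can Y • f' -> f = f'.
  move=> hf hf' e.
  have [k /(congr1 (@proj1_sig _ _)) /= ek] := fu Z (G Y) (exist _ f hf).
  have [k' /(congr1 (@proj1_sig _ _)) /= ek'] := fu Z (G Y) (exist _ f' hf').
  have mate (m : hom Z (G Y)) :
      fmap G (acounit a Y • fmap F m) • aunit a Z = m.
    by rewrite fmapM -cmpA -(aunit_nat a m) /= cmpA triangleG cmp1l.
  by rewrite -ek -ek'; congr fmap; rewrite -(mate k) -(mate k') -!e1 ek ek' e.
have tcoa : coalgebra_map (X := lift_obj (G Y)) (Y := cofree Y) (lift_can Y).
  exact: lift_can_coalgebra.
have [Z [[th hth] [[s hs] /(congr1 (@proj1_sig _ _)) /= sl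
  /(congr1 (@proj1_sig _ _)) /= sr]]] := es (cofree Y).
have [k ek] := factor Z th hth.
have hk : coalgebra_map (X := lift_obj Z) (Y := lift_obj (G Y)) (fmap F k).
  exact: (proj2_sig (fmap lift k)).
have r : lift_can Y • (fmap F k • s) = idc _ by rewrite cmpA ek sr.
exists (fmap F k • s) => //.
apply: inj.
- exact: (coalgebra_mapM (X := lift_obj (G Y)) (Y := cofree Y)
    (Z := lift_obj (G Y)) (coalgebra_mapM (X := cofree Y) (Y := lift_obj Z)
    (Z := lift_obj (G Y)) hk hs) tcoa).
- exact: coalgebra_map1.
- by rewrite cmpA r cmp1l cmp1r.
Qed.

(** Invertibility of lift_can makes the lift and the comparison functor
equivalences at the same time, and it is itself forced by the lift being one. *)
Theorem lift_equivalence :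
  is_equivalence lift <-> (forall Y, invertible (lift_can Y)) /\ comonadic F a.
Proof.
have E (ti : forall Y, invertible (lift_can Y)) :=
  is_equivalence_cancel (push_equivalence lift_can_comonad_morphism ti)
    push_comparison.
split=> [e|[ti cm]]; last exact/(E ti).
by have ti := lift_can_invertible e; split=> //; apply/(E ti).
Qed.

End Lift.

(** * Entwined modules as coalgebras *)

Section CoringComonad.
Context {V : base_category} (C : coalg V) (A : algebra V).
Context (lam : entwining C A).

Section CoringObject.
Context (Y : rmodule A).
Local Notation act := ((ract Y ⊗ C) ∘ (Y ⊗ lam)).

Lemma coring_act_arrow : arrow (Y ⊠ C ⊠ A) (Y ⊠ C) act.
Proof. by split; ty. Qed.

Lemma coring_act1 : act ∘ ((Y ⊠ C) ⊗ unt A) = Y ⊠ C.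
Proof.
rewrite idm_tob -tmorA; ra; rwr wl; rewrite ent_unt tmorA; rwr wr.
by rewrite ract1; nrm.
Qed.

Lemma coring_actA : act ∘ (act ⊗ A) = act ∘ ((Y ⊠ C) ⊗ mul A).
Proof.
rewrite idm_tob -tmorA; ra; rwr wl; rewrite ent_mul; rw wr; ra.
rw (@mcompA _ (Y ⊗ lam)).
have -> : (Y ⊗ lam) ∘ (ract Y ⊗ C ⊗ A) = (ract Y ⊗ A ⊗ C) ∘ (Y ⊗ A ⊗ lam).
  by rewrite -!idm_tob -!tmorA -!idm_tob; rw slider; rw slidel.
ra; rw mcompA; rwr wr; rewrite ractA; rw wr; ra; rw wl; rw wl.
by rewrite !tmorA.
Qed.

Definition coring_obj : rmodule A :=
  RModule coring_act_arrow coring_act1 coring_actA.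

Lemma coring_counit_map : module_map coring_obj Y (Y ⊗ cou C).
Proof.
split; first by split; ty.
rewrite /=; rw (@mcompA _ (Y ⊗ cou C)); rw slider.
have -> : ract Y ⊗ cou C = ract Y ∘ (Y ⊗ (A ⊗ cou C)).
  by rewrite tmorA -idm_tob -[ract Y in RHS]tmor1r; rw slidel.
by ra; rwr wl; rewrite ent_cou tmorA.
Qed.

End CoringObject.

Lemma coring_ob (Y : rmodule A) : rm_ob (coring_obj Y) = Y ⊠ C.
Proof. by []. Qed.
Hint Rewrite coring_ob : arr.

Lemma coring_comult_map (Y : rmodule A) :
  module_map (coring_obj Y) (coring_obj (coring_obj Y)) (Y ⊗ com C).
Proof.
split; first by split; ty.
rewrite /=; rw (@mcompA _ (Y ⊗ com C)); rw slider.
have -> : ract Y ⊗ com C = (ract Y ⊗ C ⊗ C) ∘ (Y ⊗ (A ⊗ com C)).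
  by rewrite tmorA -!idm_tob -!tmorA -!idm_tob; rw slidel.
ra; rwr wl; rewrite ent_com; rw wl; rw wl; rw (@wr _ C); ra.
by rewrite idm_tob !tmorA.
Qed.

Lemma coring_map (X Y : rmodule A) f :
  module_map X Y f -> module_map (coring_obj X) (coring_obj Y) (f ⊗ C).
Proof.
move=> [[df cf] hf]; split; first by split; ty.
rewrite /=; rw mcompA; rwr wr; rewrite hf; rw wr; ra; congr (_ ∘ _).
by rewrite -!tmorA -!idm_tob; rw slider; rw slidel.
Qed.

Definition coring_functor : functor (rmodule_cat A) (rmodule_cat A).
Proof.
refine (@Functor (rmodule_cat A) (rmodule_cat A) coring_obj
  (fun X Y f => exist _ _ (coring_map (proj2_sig f))) _ _).
- by move=> X; apply: sig_inj; rewrite /= idm_tob.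
- by move=> X Y Z [k [[dk ck] hk]] [f [[df cf] hf]]; apply: sig_inj => /=; rw wr.
Defined.

(** The comonad - ⊗_A (A ⊗ C) of the A-coring A ⊗ C, written as - ⊗ C; λ enters
only through the A-action on its values. *)
Definition coring_comonad : comonad (rmodule_cat A).
Proof.
refine (@Comonad (rmodule_cat A) coring_functor
  (fun Y => exist _ _ (coring_counit_map Y))
  (fun Y => exist _ _ (coring_comult_map Y)) _ _ _ _ _).
- move=> X Y [f [[df cf] hf]]; apply: sig_inj => /=.
  by rw slider; rewrite -{2}[f]tmor1r; rw slidel.
- move=> X Y [f [[df cf] hf]]; apply: sig_inj => /=.
  by rw slider; rewrite -tmorA -idm_tob; rw slidel.
- move=> Y; apply: sig_inj => /=.
  by rewrite idm_tob -tmorA; rwr wl; rewrite com1r; nrm.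
- move=> Y; apply: sig_inj => /=.
  by rewrite -tmorA; rwr wl; rewrite com1l; nrm.
- move=> Y; apply: sig_inj => /=.
  by rewrite idm_tob -!tmorA; rwr wl; rwr wl; rewrite comA.
Defined.

Lemma coact_module_map (X : entwined_module lam) :
  module_map X (coring_obj X) (coact X).
Proof. by split; [exact: coact_arrow | exact: coact_act]. Qed.

Definition entwined_coalgebra (X : entwined_module lam) :
  coalgebra coring_comonad.
Proof.
refine (@Coalgebra _ coring_comonad (em_rmod X)
  (exist _ _ (coact_module_map X)) _ _).
- by apply: sig_inj; exact: coact1.
- by apply: sig_inj; rewrite /= coactA.
Defined.

Definition entwined_to_coalgebra :
  functor (entwined_cat lam) (coalgebra_cat coring_comonad).
Proof.
refine (@Functor (entwined_cat lam) (coalgebra_cat coring_comonad)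
  entwined_coalgebra
  (fun X Y f => exist _ (exist _ _ (proj1 (proj2_sig f))) _) _ _).
- by move=> X; apply: sig_inj; apply: sig_inj.
- by move=> X Y Z k f; apply: sig_inj; apply: sig_inj.
Unshelve.
by move: f => [f [hf e]]; apply: sig_inj.
Defined.

(** A coaction is A-linear for the action on Y ⊗ C exactly when it satisfies the
entwined module identity, so the two categories differ only in how they bundle
the same data. *)
Lemma entwined_to_coalgebra_equivalence : is_equivalence entwined_to_coalgebra.
Proof.
apply/is_equivalenceP; split.
- by move=> X Y [f hf] [f' hf'] [e]; apply: sig_inj.
- move=> X Y [[f hf] e].
  have hf' : entwined_map X Y f by split=> //; case: e.
  by exists (exist _ f hf'); apply: sig_inj; apply: sig_inj.
move=> [Y [y [hy ey]] d1 dA].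
have e1 := congr1 (@proj1_sig _ _) d1; have eA := congr1 (@proj1_sig _ _) dA.
pose X : entwined_module lam :=
  @EntwinedModule V C A lam Y y hy e1 (esym eA) ey.
have h : @coalgebra_map _ coring_comonad (entwined_coalgebra X)
    (Coalgebra d1 dA) (idc _).
  by rewrite /coalgebra_map fmap1 cmp1l cmp1r; apply: sig_inj.
have h' : @coalgebra_map _ coring_comonad (Coalgebra d1 dA)
    (entwined_coalgebra X) (idc _).
  by rewrite /coalgebra_map fmap1 cmp1l cmp1r; apply: sig_inj.
exists X, (exist _ _ h), (exist _ _ h'); apply: sig_inj; exact: cmp1l.
Qed.

End CoringComonad.

(** * The canonical map of a module *)

Section Galois.
Context {V : base_category} (C : coalg V) (A : algebra V).
Context (lam : entwining C A) (g : grouplike C).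
Local Notation iA := (coinv_hom lam g).
Local Notation gA := (g_A lam g).
Local Notation W := (coring_comonad lam).
Local Notation F := (extension iA).
Local Notation p X := (tensor_proj X (restr_lmodule iA)).
Local Notation tA X := (tensor_over X (restr_lmodule iA)).
Local Notation tAY Y := (tA (restr_rmodule iA Y)).
Local Notation pY Y := (p (restr_rmodule iA Y)).
Hint Rewrite @dom_i @cod_i @dom_gA @cod_gA @dom_Fbar_coact @cod_Fbar_coact
  @dom_proj @cod_proj @restr_lmodule_ob @restr_rmodule_ob
  @dom_ext_act @cod_ext_act @extension_ob @coring_ob : arr.

Definition ext_coaction (X : rmodule_cat (coinv_alg lam g)) :
  hom (F X) (W (F X)) :=
  exist _ _ (coact_module_map (Fbar lam g X)).

Lemma ext_coaction_nat :
  natural (F := F) (G := compF W F) ext_coaction.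
Proof.
move=> X Y [f hf]; apply: sig_inj => /=.
by case: (Fbar_map hf).
Qed.

Lemma ext_coaction_counit X :
  cmd_counit W (F X) • ext_coaction X = idc (F X).
Proof. by apply: sig_inj; exact: Fbar_coact1. Qed.

Lemma ext_coaction_coassoc X :
  cmd_comult W (F X) • ext_coaction X = fmap W (ext_coaction X) • ext_coaction X.
Proof. by apply: sig_inj => /=; rewrite Fbar_coactA. Qed.

Local Notation K := (lift ext_coaction_nat ext_coaction_counit ext_coaction_coassoc).

(** Both functors have the same values, up to the bundling of entwined modules
as coalgebras. *)
Lemma Fbar_lift : is_equivalence (Fbar lam g) <-> is_equivalence K.
Proof.
apply: is_equivalence_cancel (entwined_to_coalgebra_equivalence lam) _.
have h X : @coalgebra_map _ W (entwined_coalgebra (Fbar lam g X))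
    (K X) (idc _).
  by rewrite /coalgebra_map fmap1 cmp1l cmp1r.
have h' X : @coalgebra_map _ W (K X)
    (entwined_coalgebra (Fbar lam g X)) (idc _).
  by rewrite /coalgebra_map fmap1 cmp1l cmp1r.
exists (fun X => exist _ _ (h X)), (fun X => exist _ _ (h' X)).
split=> [X Y f|X|X]; apply: sig_inj; last 2 first.
- exact: cmp1l.
- exact: cmp1l.
by rewrite [LHS]cmp1l [RHS]cmp1r; apply: sig_inj.
Qed.

Local Notation t Y := (lift_can (ext_restr_adjunction iA) ext_coaction Y).

(** The arrow Y ⊗_B A -> Y ⊗ C, which generalizes can from A to a module Y. *)
Definition can_at (Y : rmodule A) : mor V := proj1_sig (t Y).

Lemma can_atP (Y : rmodule A) :
  arrow (tAY Y) (Y ⊠ C) (can_at Y) /\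
  can_at Y ∘ pY Y = (ract Y ⊗ C) ∘ (Y ⊗ gA).
Proof.
split; first by case: (proj2_sig (t Y)).
rewrite /can_at /=; have [hY eY] := ext_counitP iA Y.
have [h e] := Fbar_coactP (lam := lam) (g := g) (restr_rmodule iA Y).
by ra; rewrite e; rw mcompA; rwr wr; rewrite eY.
Qed.

Lemma can_at_regular : can_at (regular_rmodule A) = can lam g.
Proof.
have [h e] := can_atP (regular_rmodule A); have [h' e'] := canP lam g.
apply: (@tensor_proj_epi _ _ (restr_rmodule iA (regular_rmodule A))
  (restr_lmodule iA)); try solve [ty].
by rewrite e e'.
Qed.

Lemma invertible_module_map (B : algebra V) (X Y : rmodule_cat B)
  (f : hom X Y) : invertible f <-> is_iso (proj1_sig f).
Proof.
case: f => f [[df cf] hf] /=; split.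
  move=> [[k [[dk ck] hk]] /(congr1 (@proj1_sig _ _)) /= e
    /(congr1 (@proj1_sig _ _)) /= e'].
  by exists k; rewrite ?df ?cf.
move=> [k [dk ck] [e e']]; rewrite cf in dk e'; rewrite df in ck e.
have hk : module_map Y X k.
  split=> //.
  have -> : k ∘ ract Y = k ∘ (ract Y ∘ ((f ∘ k) ⊗ B)) by rewrite e'; nrm.
  rw wr; rw (@mcompA _ (ract Y)); rewrite -hf; ra.
  by rw mcompA; rewrite e; nrm.
by exists (exist _ k hk); apply: sig_inj.
Qed.

Local Notation AA := (tAY (regular_rmodule A)).
Local Notation pA := (pY (regular_rmodule A)).

(** The arrow ξ_Y ⊗_B A from Y ⊗ (A ⊗_B A), seen as (Y ⊗ A) ⊗_B A, to Y ⊗_B A.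
For Y = A it is the left action of A on A ⊗_B A. *)
Definition act_tensor (Y : rmodule A) : mor V :=
  desc (Y ⊗ pA) (pY Y ∘ (ract Y ⊗ A)).

Lemma act_tensorP (Y : rmodule A) :
  arrow (Y ⊠ AA) (tAY Y) (act_tensor Y) /\
  act_tensor Y ∘ (Y ⊗ pA) = pY Y ∘ (ract Y ⊗ A).
Proof.
have P := tensor_coequalizerl Y
  (tensor_projP (restr_rmodule iA (regular_rmodule A)) (restr_lmodule iA)).
have -> : Y ⊠ AA = cod (Y ⊗ pA) by ty.
have -> : tAY Y = cod (pY Y ∘ (ract Y ⊗ A)) by ty.
apply: (descP P); first by ty.
case: (tensor_projP (restr_rmodule iA Y) (restr_lmodule iA)) => _ _ e _.
have E : (ract Y ⊗ A) ∘ (Y ⊗ (ract (restr_rmodule iA (regular_rmodule A)) ⊗ A))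
    = (ract (restr_rmodule iA Y) ⊗ A) ∘ (ract Y ⊗ coinv_alg lam g ⊗ A).
  rewrite tmorA; rwr wr; rwr wr; congr (_ ⊗ _).
  rewrite /=; ra; rw slider; rewrite -(@ractAe _ _ Y); try ty.
  by nrm.
have E' : (ract Y ⊗ A) ∘ (Y ⊗ (A ⊗ lact (restr_lmodule iA)))
    = (Y ⊗ lact (restr_lmodule iA)) ∘ (ract Y ⊗ coinv_alg lam g ⊗ A).
  by rewrite tmorA -[X in _ = _ ∘ X]tmorA -!idm_tob; rw slidel; rw slider.
by rw acomp; rewrite E; rw mcompA; rewrite e; ra; rewrite E'.
Qed.

Lemma act_tensor_epi (Y : ob V) k k' : dom k = Y ⊠ AA -> dom k' = Y ⊠ AA ->
  k ∘ (Y ⊗ pA) = k' ∘ (Y ⊗ pA) -> k = k'.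
Proof.
move=> hk hk'; apply: (coequalizer_epi (tensor_coequalizerl Y
  (tensor_projP (restr_rmodule iA (regular_rmodule A)) (restr_lmodule iA)))).
  by rewrite hk; ty.
by rewrite hk'; ty.
Qed.

(** Relates can_at Y to can; for Y = A it says that can is left A-linear. *)
Lemma can_at_act (Y : rmodule A) :
  can_at Y ∘ act_tensor Y = (ract Y ⊗ C) ∘ (Y ⊗ can lam g).
Proof.
have [h e] := can_atP Y; have [h' e'] := act_tensorP Y.
have [h'' e''] := canP lam g.
apply: (@act_tensor_epi Y); try solve [ty].
ra; rewrite e'; rw mcompA; rewrite e; ra; rwr wl; rewrite e''.
rw slider; rw wl; rewrite !tmorA; rw mcompA; rwr wr; rewrite -ractA.
by rw wr; ra; rewrite -!idm_tob -!tmorA -!idm_tob; rw slidel.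
Qed.

(** The arrow act_tensor Y is balanced over A, so that it would descend to the
isomorphism from Y ⊗_A (A ⊗_B A) to Y ⊗_B A. *)
Lemma act_tensorA (Y : rmodule A) :
  act_tensor Y ∘ (ract Y ⊗ AA)
    = act_tensor Y ∘ (Y ⊗ act_tensor (regular_rmodule A)).
Proof.
have [h e] := act_tensorP Y; have [h' e'] := act_tensorP (regular_rmodule A).
apply: (@act_tensor_epi (Y ⊠ A)); try solve [ty].
ra; rw slidel; rewrite idm_tob -tmorA; rwr wl; rewrite e' /=; rw wl.
rw mcompA; rewrite e; ra; rewrite tmorA; rwr wr; rewrite -ractA; rw wr.
rw mcompA; rewrite -e; ra; congr (_ ∘ _).
by rewrite -tmorA -idm_tob; rw slider.
Qed.

(** With k the inverse of can, the inverse of can_at Y is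
Y ⊗ C -> Y ⊗ A ⊗ C -> Y ⊗ (A ⊗_B A) -> Y ⊗_B A, composed of Y ⊗ e_A ⊗ C,
Y ⊗ k and act_tensor Y.  That it is a right inverse is the formula can_at_act;
that it is a left inverse uses that k is A-linear and that k g_A is the class
of e_A ⊗ A. *)
Lemma galois_can_at (Y : rmodule A) : galois lam g -> is_iso (can_at Y).
Proof.
have [h e] := can_atP Y; have [h' e'] := act_tensorP Y.
have [h'' e''] := canP lam g; have [r er] := act_tensorP (regular_rmodule A).
move=> [k [dk ck] [kl kr]].
have ck' : cod k = AA by ty.
have dk' : dom k = A ⊠ C by ty.
have kl' : k ∘ can lam g = AA by rewrite kl; ty.
have kr' : can lam g ∘ k = A ⊗ C by rewrite kr -idm_tob; ty.
have k_linear : act_tensor (regular_rmodule A) ∘ (A ⊗ k) = k ∘ (mul A ⊗ C).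
  have E := can_at_act (regular_rmodule A); rewrite can_at_regular /= in E.
  have -> : act_tensor (regular_rmodule A) ∘ (A ⊗ k)
      = (k ∘ can lam g) ∘ (act_tensor (regular_rmodule A) ∘ (A ⊗ k)).
    by rewrite kl'; nrm.
  ra; rw (@mcompA _ (can lam g)); rewrite E; ra; rwr wl; rewrite kr'.
  by nrm.
have k_gA : k ∘ gA = pA ∘ (unt A ⊗ A).
  have -> : gA = can lam g ∘ (pA ∘ (unt A ⊗ A)).
    rw mcompA; rewrite e''; ra; rw slider.
    have -> : unt A ⊗ gA = (unt A ⊗ A ⊗ C) ∘ gA.
      by rewrite -tmorA -idm_tob; rw slidel1.
    by rw mcompA; rwr wr; rewrite mul1l; nrm.
  by rw mcompA; rewrite kl'; nrm.
exists (act_tensor Y ∘ ((Y ⊗ k) ∘ (Y ⊗ unt A ⊗ C))).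
  by split; ty.
split; last first.
  rw mcompA; rewrite can_at_act; ra; rw (@mcompA _ (Y ⊗ can lam g)); rwr wl.
  rewrite kr'; nrm; rwr wr; rewrite ract1 -idm_tob; ty.
apply: (@tensor_proj_epi _ _ (restr_rmodule iA Y) (restr_lmodule iA));
  try solve [ty].
ra; rewrite e; rw (@mcompA _ (Y ⊗ unt A ⊗ C)); rwr wr; rw (@slider1 _ Y (ract Y)).
(* move the action on Y past k, then over to the A-linear k *)
have -> : ract Y ⊗ unt A = (ract Y ⊗ A) ∘ (Y ⊗ A ⊗ unt A).
  by rewrite -idm_tob; rw slidel.
rw wr; ra; rw (@mcompA _ (Y ⊗ k)).
have -> : (Y ⊗ k) ∘ (ract Y ⊗ A ⊗ C) = (ract Y ⊗ AA) ∘ (Y ⊗ (A ⊗ k)).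
  by rewrite (tmorA Y) -(tmorA (ract Y)) -!idm_tob; rw slider; rw slidel.
ra; rw mcompA; rewrite act_tensorA; ra; rw (@mcompA _ (Y ⊗ act_tensor _)).
rwr wl; rewrite k_linear; rw (@mcompA _ (Y ⊗ _)).
have -> : Y ⊗ A ⊗ unt A ⊗ C = Y ⊗ (A ⊗ unt A ⊗ C) by rewrite !tmorA.
rwr wl; ra; rwr wr; rewrite mul1r; nrm; rwr wl; rewrite k_gA; rw wl.
rw mcompA; rewrite e'; ra; rewrite tmorA; rwr wr; rewrite ract1; by nrm.
Qed.

Lemma can_at_galois : (forall Y, invertible (t Y)) <-> galois lam g.
Proof.
split=> [ti|gal Y]; last exact/invertible_module_map/galois_can_at.
rewrite /galois -can_at_regular; exact/invertible_module_map.
Qed.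

End Galois.

Theorem theorem5p5 (V : base_category) (C : coalg V) (A : algebra V)
    (lam : entwining C A) (g : grouplike C) :
  is_equivalence (Fbar lam g) <->
  galois lam g /\
  comonadic (extension (coinv_hom lam g))
            (ext_restr_adjunction (coinv_hom lam g)).
Proof.
by rewrite Fbar_lift (lift_equivalence (ext_restr_adjunction _)) can_at_galois.
Qed.
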